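(* Let $M$ be a closed Riemannian manifold and $f:M\to M$ a $C^1$ diffeomorphism. Let $\{B_i\}$ be a covering of $M$ by weak dynamical boxes with compatible unstable cones and assume that the unstable cones are uniformly expanded by $Df$. Then $f$ has a weak partially hyperbolic splitting $TM=E^{cs}\oplus E^u$.
   Context: Fix $u,s$ with $u+s=\dim M$ and let $R=[-1,1]^u\times[-1,1]^s$. A cone in a vector space $V$ is a subset $\mathcal{C}$ with $av\in\mathcal{C}$ for all $v\in\mathcal{C}$, $a\in\mathbb{R}$; its dimension is the dimension of the largest linear subspace it contains. For cones $\mathcal{B},\mathcal{C}\subset V$, $\mathcal{B}$ lies in the interior of $\mathcal{C}$ if every non-zero vector of $\mathcal{B}$ lies in the interior of $\mathcal{C}$. A weak dynamical box $B$ is the image of a $C^1$ embedding $\varphi:R\to M$ equipped with a cone family $\mathcal{C}^u$ on $R$ (which defines cones in $TM$ via $D\varphi$), of dimension $u$ and transverse to $\{x\}\times[-1,1]^s$ for all $x$. Weak dynamical boxes $\{B_i\}$ (with embeddings $\varphi_i$ and cone families $\mathcal{C}^u_i$) have compatible unstable cones if for all $i,j$ and every point $\varphi_i(p)\in B_i$ with $f(\varphi_i(p))\in B_j$, the derivative at $p$ of $f_{\mathrm{loc}}=\varphi_j^{-1}\circ f\circ\varphi_i$ maps $\mathcal{C}^u_i(p)$ into the interior of $\mathcal{C}^u_j(f_{\mathrm{loc}}(p))$. Uniformly expanded by $Df$: there is $\lambda>1$ such that $\|Df\,v\|\ge\lambda\|v\|$ for every $v$ in the cones $D\varphi_i\,\mathcal{C}^u_i$.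 A weak partially hyperbolic splitting $E^{cs}\oplus E^u$ is a $Df$-invariant splitting $TM=E^{cs}\oplus E^u$, with $\dim E^u=u$, in which $E^u$ is uniformly expanded and dominates $E^{cs}$ (i.e. $\|Df_pv^{cs}\|<\|Df_pv^u\|$ and $\|Df_pv^u\|>1$ for all $p$ and unit vectors $v^{cs}\in E^{cs}_p$, $v^u\in E^u_p$).
   Formalization: Cone families are taken to be continuous families of closed cones, finitely many of the boxes are assumed to cover M, and the one-step inequalities defining the splitting hold for an adapted continuous metric (E^u is still uniformly expanded in the given one). *)

(* Defs.v *)
From HB Require Import structures.
From mathcomp Require Import all_boot all_order all_algebra.
From mathcomp Require Import all_classical all_reals all_analysis.

Set Implicit Arguments.
Unset Strict Implicit.
Unset Printing Implicit Defensive.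

Import Order.TTheory GRing.Theory Num.Theory.
Import numFieldNormedType.Exports.

Local Open Scope classical_set_scope.
Local Open Scope ring_scope.

(* [Ck k U h]: h is of class C^k on U, where U is meant to be open. *)
Fixpoint Ck (R : realType) (V W : normedModType R) (k : nat) (U : set V)
    (h : V -> W) : Prop :=
  match k with
  | 0%N => forall x, U x -> {for x, continuous h}
  | k'.+1 => (forall x, U x -> differentiable h x) /\
             (forall v, Ck k' U (fun x => 'D_v h x))
  end.

Definition Csmooth (R : realType) (V W : normedModType R) (U : set V)
  (h : V -> W) : Prop := forall k, Ck k U h.

(* Closed (= compact without boundary) smooth manifolds of dimension n.
   [coord a] and [icoord a] are total functions, meaningful only on [dom a] and
   on [coord a @` dom a].  Second countability follows from compactness.
   [chart_at x] is a preferred chart around x. *)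
Record closed_manifold (R : realType) (n : nat) := ClosedManifold {
  carrier :> topologicalType;
  carrier_hausdorff : hausdorff_space carrier;
  carrier_compact : compact [set: carrier];
  chart : Type;
  dom : chart -> set carrier;
  coord : chart -> carrier -> 'rV[R]_n;
  icoord : chart -> 'rV[R]_n -> carrier;
  chart_at : carrier -> chart;
  dom_chart_at : forall x, dom (chart_at x) x;
  open_dom : forall a, open (dom a);
  open_coord : forall a, open (coord a @` dom a);
  coordK : forall a x, dom a x -> icoord a (coord a x) = x;
  coord_continuous : forall a x, dom a x -> {for x, continuous (coord a)};
  icoord_continuous :
    forall a x, dom a x -> {for coord a x, continuous (icoord a)};
  transition_smooth : forall a b,
    Csmooth (coord a @` (dom a `&` dom b)) (coord b \o icoord a)
}.

Section Manifolds.
Context {R : realType} {n : nat} (M : closed_manifold R n).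

(* The tangent space T_xM is modelled as 'rV[R]_n, a tangent vector at x being
   given by its coordinates in the preferred chart [chart_at x].
   [of_chart a x v] is the vector of T_xM whose coordinates in chart a are v. *)
Definition of_chart (a : chart M) (x : M) (v : 'rV[R]_n) : 'rV[R]_n :=
  'd (coord (chart_at x) \o icoord a) (coord a x) v.

Definition C1_map (f : M -> M) : Prop :=
  continuous f /\
  forall a b, Ck 1 (coord a @` (dom a `&` f @^-1` dom b))
                   (coord b \o f \o icoord a).

Definition C1_diffeo (f : M -> M) : Prop :=
  exists h : M -> M, [/\ C1_map f, C1_map h, cancel f h & cancel h f].

(* D f_x : T_xM -> T_(f x)M *)
Definition tmap (f : M -> M) (x : M) (v : 'rV[R]_n) : 'rV[R]_n :=
  'd (coord (chart_at (f x)) \o f \o icoord (chart_at x))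
     (coord (chart_at x) x) v.

Definition C1_param (U : set 'rV[R]_n) (phi : 'rV[R]_n -> M) : Prop :=
  (forall p, U p -> {for p, continuous phi}) /\
  forall b, Ck 1 (U `&` phi @^-1` dom b) (coord b \o phi).

(* D phi_p : R^n -> T_(phi p)M *)
Definition tparam (phi : 'rV[R]_n -> M) (p v : 'rV[R]_n) : 'rV[R]_n :=
  'd (coord (chart_at (phi p)) \o phi) p v.

Record inner_products (g : M -> 'rV[R]_n -> 'rV[R]_n -> R) : Prop := {
  inner_linear :
    forall x a v v' w, g x (a *: v + v') w = a * g x v w + g x v' w;
  inner_sym : forall x v w, g x v w = g x w v;
  inner_pos : forall x v, v != 0 -> 0 < g x v v
}.

Definition metric_class (k : nat) (g : M -> 'rV[R]_n -> 'rV[R]_n -> R) : Prop :=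
  forall a v w, Ck k (coord a @` dom a)
    (fun y => g (icoord a y) (of_chart a (icoord a y) v)
                             (of_chart a (icoord a y) w) : R^o).

Definition riemannian_metric (g : M -> 'rV[R]_n -> 'rV[R]_n -> R) : Prop :=
  inner_products g /\ forall k, metric_class k g.

Definition continuous_riemannian_metric
  (g : M -> 'rV[R]_n -> 'rV[R]_n -> R) : Prop :=
  inner_products g /\ metric_class 0 g.

Definition tnorm (g : M -> 'rV[R]_n -> 'rV[R]_n -> R) (x : M) (v : 'rV[R]_n)
  : R := Num.sqrt (g x v v).

(* E is a continuous subbundle of TM: it is locally spanned by a continuous
   frame e_0, ..., e_(d-1), written here in the chart around x0. *)
Definition subbundle (E : M -> {vspace 'rV[R]_n}) : Prop :=
  forall x0 : M, exists d (e : 'I_d -> M -> 'rV[R]_n),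
    \forall x \near x0,
      (forall k, {for x, continuous (e k)}) /\
      basis_of (E x) [seq of_chart (chart_at x0) x (e k x) | k <- enum 'I_d].

(* The expansion of E^u holds for the metric g; the one-step inequalities
   between unit vectors hold for an adapted metric g', as they cannot be
   expected for every metric: an invariant bundle that is contracted in the long
   run may be stretched arbitrarily by Df at a given point for a suitable g. *)
Record weak_ph_splitting (g : M -> 'rV[R]_n -> 'rV[R]_n -> R) (f : M -> M)
    (u : nat) (Ecs Eu : M -> {vspace 'rV[R]_n}) : Prop := {
  ph_cs_bundle : subbundle Ecs;
  ph_u_bundle : subbundle Eu;
  ph_sum : forall x, (Ecs x + Eu x)%VS = fullv;
  ph_cap : forall x, (Ecs x :&: Eu x)%VS = 0%VS;
  ph_dim : forall x, \dim (Eu x) = u;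
  ph_cs_inv : forall x, tmap f x @` [set` Ecs x] = [set` Ecs (f x)];
  ph_u_inv : forall x, tmap f x @` [set` Eu x] = [set` Eu (f x)];
  ph_expansion : exists2 lambda : R, 1 < lambda &
    forall x v, v \in Eu x -> lambda * tnorm g x v <= tnorm g (f x) (tmap f x v);
  ph_domination :
    exists2 g' : M -> 'rV[R]_n -> 'rV[R]_n -> R,
      continuous_riemannian_metric g' &
      (forall x vu, vu \in Eu x -> tnorm g' x vu = 1 ->
         1 < tnorm g' (f x) (tmap f x vu)) /\
      (forall x vcs vu, vcs \in Ecs x -> vu \in Eu x ->
         tnorm g' x vcs = 1 -> tnorm g' x vu = 1 ->
         tnorm g' (f x) (tmap f x vcs) < tnorm g' (f x) (tmap f x vu))
}.

End Manifolds.

Section Cones.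
Context {R : realType} {n : nat}.

Definition cone (C : set 'rV[R]_n) : Prop := forall a v, C v -> C (a *: v).

Definition cone_dim (C : set 'rV[R]_n) (d : nat) : Prop :=
  (exists2 W : {vspace 'rV[R]_n}, [set` W] `<=` C & \dim W = d) /\
  (forall W : {vspace 'rV[R]_n}, [set` W] `<=` C -> (\dim W <= d)%N).

Definition in_interior (B C : set 'rV[R]_n) : Prop :=
  forall v, B v -> v != 0 -> C° v.

End Cones.

Section Boxes.
Context {R : realType} {u s : nat}.

Definition cube : set 'rV[R]_(u + s) := [set p | forall i, `|p 0 i| <= 1].

(* A cone family is a continuous family of closed cones: its total space is
   closed, and the interiors of its fibres form a relatively open set. *)
Record cone_family (C : 'rV[R]_(u + s) -> set 'rV[R]_(u + s)) : Prop := {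
  family_cone : forall p, cube p -> cone (C p);
  family_closed : closed [set z | cube z.1 /\ C z.1 z.2];
  family_interior : forall p v, cube p -> (C p)° v ->
    \forall z \near (p, v), cube z.1 -> C z.1 z.2
}.

(* [phi] is only meaningful on the cube; being C^1 on the closed cube means
   having a C^1 extension to a neighbourhood. *)
Record weak_box (M : closed_manifold R (u + s)) := WeakBox {
  param : 'rV[R]_(u + s) -> M;
  param_C1 : exists U, [/\ open U, cube `<=` U & C1_param U param];
  param_inj : forall p q, cube p -> cube q -> param p = param q -> p = q;
  param_immersion : forall p v, cube p -> tparam param p v = 0 -> v = 0;
  ucone : 'rV[R]_(u + s) -> set 'rV[R]_(u + s);
  ucone_family : cone_family ucone;
  ucone_dim : forall p, cube p -> cone_dim (ucone p) u;
  (* {x} x [-1,1]^s is tangent to the vectors whose first u entries vanish *)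
  ucone_transverse :
    forall p v, cube p -> ucone p v -> lsubmx v = 0 -> v = 0
}.

Context {M : closed_manifold R (u + s)}.

(* Covering in the sense of compact spaces: finitely many of the (closed) boxes
   already cover M. *)
Definition covering (I : Type) (B : I -> weak_box M) : Prop :=
  exists2 J : set I, finite_set J &
    forall x : M, exists2 i, J i & (param (B i) @` cube) x.

(* The domain of f_loc need not be a neighbourhood of p, so the image of C^u_i(p)
   under D f_loc = (D phi_j)^-1 o Df o D phi_i is written as a preimage under the
   linear isomorphism D phi_j at q = f_loc p. *)
Definition compatible_unstable_cones (f : M -> M) (I : Type)
    (B : I -> weak_box M) : Prop :=
  forall i j p q, cube p -> cube q -> param (B j) q = f (param (B i) p) ->
    in_interior
      (tparam (param (B j)) q @^-1`
         ((tmap f (param (B i) p) \o tparam (param (B i)) p) @` ucone (B i) p))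
      (ucone (B j) q).

Definition cones_uniformly_expanded (g : M -> 'rV[R]_(u + s) ->
    'rV[R]_(u + s) -> R) (f : M -> M) (I : Type) (B : I -> weak_box M) : Prop :=
  exists2 lambda : R, 1 < lambda &
    forall i p v, cube p -> ucone (B i) p v ->
      let x := param (B i) p in let w := tparam (param (B i)) p v in
      lambda * tnorm g x w <= tnorm g (f x) (tmap f x w).

End Boxes.

(* Main.v *)
(* Let C(x) be the union of the cones at x of finitely many boxes covering M. By
   compatibility, Df maps the nonzero vectors of C into its interior, uniformly in
   angle by compactness. If v lies in Df C and w never enters C under iteration,
   the segment of t for which Df^n (v + t w) stays in C grows at each step, which
   forces |Df^n v| / |Df^n w| to grow exponentially: vectors of the cone dominate
   vectors that avoid it, although the cones need not be convex.

   A limit of the images of u-dimensional subspaces of C is a u-dimensional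
   subspace of vectors whose whole backward orbit lies in C, and a limit of
   preimages of complements of C is an s-dimensional subspace of vectors that
   never enter C. By domination, these subspaces contain all vectors with these
   properties; hence they are invariant and vary continuously with x. The adapted
   metric is Gourmelon's. *)

From HB Require Import structures.
Require Import Defs.
From mathcomp Require Import all_boot all_order all_algebra.
From mathcomp Require Import all_classical all_reals all_analysis.
From mathcomp Require Import ring lra.

Set Implicit Arguments.
Unset Strict Implicit.
Unset Printing Implicit Defensive.

Import Order.TTheory GRing.Theory Num.Theory.
Import numFieldNormedType.Exports.

Local Open Scope classical_set_scope.
Local Open Scope ring_scope.

(** Three obstacles shape the proof. The cones are not convex, so neither the trapped nor the
    avoiding vectors are known in advance to be closed under addition. Every estimate therefore
    rests on one number [eps]: a vector within relative distance [eps] of the image of a cone vector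
    is again in the cone. Compactness supplies [eps], and the domination rate [kappa = eps ^+ 3 / 2]
    is computed from it without topology. The coordinates on T_xM come from a preferred chart that
    may jump with x, so continuity over TM is phrased with the filter [tnbhs]. Continuity of the
    bundles is not estimated: both have closed total spaces and complementary constant dimensions,
    and compactness does the rest. Finally, domination is obtained only up to a constant factor,
    whereas the splitting asks for strict inequalities at every single step. This is why the metric
    has to be changed, and expansion of the cones makes the weights of the new metric exceed 1. *)

Lemma geometric_bound (R : realType) (k b c : R) :
  0 < k -> (forall n, (1 + k) ^+ n * b <= c) -> b <= 0.
Proof.
move=> k0 H; rewrite leNgt; apply/negP => b0.
have bern n : 1 + k *+ n <= (1 + k) ^+ n.
  elim: n => [|n IH]; first by rewrite mulr0n addr0.
  rewrite exprS; apply: (@le_trans _ _ ((1 + k) * (1 + k *+ n))).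
    have : 0 <= k * (k *+ n) by rewrite mulr_ge0 ?mulrn_wge0// ltW.
    by rewrite mulrSr; lra.
  by apply: ler_wpM2l => //; rewrite addr_ge0 ?ltW.
have kb0 : 0 < k * b by rewrite mulr_gt0.
have := archi_boundP (ltW (divr_gt0 (ltr_pwDr ltr01 (normr_ge0 c)) kb0)).
set n := Num.bound _; rewrite ltr_pdivrMr// => Hn.
have := H n; apply/negP; rewrite -ltNge.
apply: (@lt_le_trans _ _ ((1 + k *+ n) * b)); last by rewrite ler_wpM2r// ltW.
rewrite mulrDl mul1r -mulr_natl -mulrA (le_lt_trans (ler_norm c))//.
by rewrite ltr_wpDl ?(ltW b0)// (le_lt_trans _ Hn)// lerDl.
Qed.

Section LinearFun.
Variables (R : nzRingType) (V W : lmodType R) (h : V -> W).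
Hypothesis hlin : linear h.

Lemma linear_zero : h 0 = 0.
Proof. by have := hlin (-1) 0 0; rewrite scaler0 addr0 scaleN1r addNr. Qed.

Lemma linear_scale a v : h (a *: v) = a *: h v.
Proof. by have := hlin a v 0; rewrite linear_zero !addr0. Qed.

Lemma linear_add v w : h (v + w) = h v + h w.
Proof. by have := hlin 1 v w; rewrite !scale1r. Qed.

Lemma linear_opp v : h (- v) = - h v.
Proof. by rewrite -scaleN1r linear_scale scaleN1r. Qed.

End LinearFun.

(** * Vectors of a cone dominate vectors avoiding it *)

Section Push.
Variables (R : nzRingType) (T : Type) (V : lmodType R).
Variables (f : T -> T) (A : T -> V -> V).
Hypothesis Alin : forall x a v w, A x (a *: v + w) = a *: A x v + A x w.

(** The cocycle generated by [A] over [f]; for [A = tmap f] it is the derivative of the [k]-th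
    iterate of [f] at [x]. *)
Fixpoint push (k : nat) (x : T) (v : V) : V :=
  if k is k'.+1 then A (iter k' f x) (push k' x v) else v.

Lemma push_addn j k x v : push (j + k) x v = push j (iter k f x) (push k x v).
Proof. by elim: j => //= j ->; rewrite iterD. Qed.

Lemma pushSr k x v : push k.+1 x v = push k (f x) (A x v).
Proof. by rewrite -addn1 push_addn. Qed.

Lemma push_lin k x a v w :
  push k x (a *: v + w) = a *: push k x v + push k x w.
Proof. by elim: k => //= k ->; rewrite Alin. Qed.

Lemma push_scalev k x a v : push k x (a *: v) = a *: push k x v.
Proof. exact: (@linear_scale _ _ _ (push k x) (push_lin k x)). Qed.

Lemma push_addv k x v w : push k x (v + w) = push k x v + push k x w.
Proof. exact: (@linear_add _ _ _ (push k x) (push_lin k x)). Qed.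

Lemma push_zero k x : push k x 0 = 0.
Proof. exact: (@linear_zero _ _ _ (push k x) (push_lin k x)). Qed.

End Push.

Section Cocycle.
Variables (R : realType) (T : Type) (V : lmodType R).
Variables (f : T -> T) (A : T -> V -> V).
Hypothesis Alin : forall x a v w, A x (a *: v + w) = a *: A x v + A x w.

Local Notation fpush := (push f A).
Local Notation push_zero := (push_zero f Alin).
Local Notation push_scalev := (push_scalev f Alin).

Variable N : T -> V -> R.
Hypothesis NZ : forall x a v, N x (a *: v) = `|a| * N x v.
Hypothesis ND : forall x v w, N x (v + w) <= N x v + N x w.
Hypothesis N_gt0 : forall x v, v != 0 -> 0 < N x v.

Lemma N0 x : N x 0 = 0.
Proof. by rewrite -(scale0r 0) NZ normr0 mul0r. Qed.

Lemma N_ge0 x v : 0 <= N x v.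
Proof. by have [->|/N_gt0/ltW//] := eqVneq v 0; rewrite N0. Qed.

Lemma NN x v : N x (- v) = N x v.
Proof. by rewrite -scaleN1r NZ normrN1 mul1r. Qed.

Variable C : T -> V -> Prop.
Hypothesis CZ : forall x a v, C x v -> C x (a *: v).
Hypothesis A_inj : forall x v, A x v = 0 -> v = 0.
Variable eps : R.
Hypothesis eps_gt0 : 0 < eps.
Hypothesis eps_lt1 : eps < 1.
Hypothesis C_open : forall x v w, C x v ->
  N (f x) (w - A x v) <= eps * N (f x) (A x v) -> C (f x) w.

Lemma C_step x v : C x v -> C (f x) (A x v).
Proof. by move=> Cv; apply: C_open Cv _;
  rewrite subrr N0 mulr_ge0 ?N_ge0 ?ltW. Qed.

Lemma C_push k x v : C x v -> C (iter k f x) (fpush k x v).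
Proof. by move=> Cv; elim: k => //= k; exact: C_step. Qed.

Lemma push_inj k x v : fpush k x v = 0 -> v = 0.
Proof. by elim: k => //= k IH /A_inj. Qed.

(* The vectors that never enter the cone form E^cs, and those whose backward
   orbit stays in it ([trapped] below) form E^u. *)
Definition avoids (x : T) (w : V) : Prop :=
  forall k, C (iter k f x) (fpush k x w) -> fpush k x w = 0.

Lemma avoidsZ x a w : avoids x w -> avoids x (a *: w).
Proof.
move=> Kw k; rewrite push_scalev; have [->|a0] := eqVneq a 0;
  first by rewrite scale0r.
move=> /(CZ a^-1); rewrite scalerA mulVf// scale1r => /Kw ->.
by rewrite scaler0.
Qed.

Lemma avoids_step x w : avoids x w <-> avoids (f x) (A x w).
Proof.
split=> [Kw k|Kw k].
  by rewrite -iterSr -pushSr; exact: Kw.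
case: k => [Cw|k]; last by rewrite iterSr pushSr; exact: Kw.
by apply: (@push_inj 1 x); apply: (Kw 0%N); exact: C_step.
Qed.

Lemma avoids_push k x w : avoids x w <-> avoids (iter k f x) (fpush k x w).
Proof. by elim: k => // k ->; exact: avoids_step. Qed.

(** If the sum were shorter, [- w] would be so close to [A x v] that it lies in the cone; an
    avoiding vector in the cone is 0, and then [eps < 1] gives a contradiction. *)
Lemma angle_cone x v w : C x v -> avoids (f x) w ->
  eps * N (f x) (A x v) <= N (f x) (A x v + w).
Proof.
move=> Cv Kw; rewrite leNgt; apply/negP => lt.
have w0 : w = 0.
  have /(_ 0%N)/= := avoidsZ (a := -1) Kw; rewrite scaleN1r => H.
  rewrite -[w]opprK H ?oppr0//; apply: (C_open Cv).
  by rewrite -NN opprB opprK ltW.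
by move: lt; rewrite w0 addr0 ltNge ler_piMl ?N_ge0// ltW.
Qed.

Lemma angle_avoids x v w : C x v -> avoids (f x) w ->
  eps * N (f x) w <= 2 * N (f x) (A x v + w).
Proof.
move=> Cv Kw; have := angle_cone Cv Kw; have := N_ge0 (f x) (A x v + w).
have : N (f x) w <= N (f x) (A x v + w) + N (f x) (A x v).
  by rewrite -(NN _ (A x v)); apply: le_trans (ND _ _ _);
    rewrite addrAC subrr add0r.
set a := N _ _; set b := N _ _; set c := N _ _ => H1 H2 H3.
apply: (@le_trans _ _ (eps * (b + c))); first by rewrite ler_wpM2l// ltW.
rewrite mulrDr; have : eps * b <= b by rewrite ler_piMl// ltW.
by move: H3; lra.
Qed.

Let kappa := eps ^+ 3 / 2.

(* The ratios r_k = |A^k v| / |A^k w| satisfy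
   r_(k+1) >= kappa * (r_0 + ... + r_k): the segment of t such that
   A^k (v + t w) lies in the cone grows by at least eps^2 r_k at each step, and
   the angle between the cone and the avoiding vectors bounds its length by
   (2 / eps) r_(k+1). *)
Lemma cone_domination x v w k : C x v -> avoids (f x) w ->
  kappa * (1 + kappa) ^+ k *
    (N (iter k f (f x)) (fpush k (f x) w) * N (f x) (A x v)) <=
  (1 + kappa) * (N (iter k f (f x)) (fpush k (f x) (A x v)) * N (f x) w).
Proof.
move=> Cv Kw.
have k0 : 0 < kappa by rewrite /kappa divr_gt0// exprn_gt0.
have k1 : kappa < 1.
  rewrite /kappa ltr_pdivrMr// mul1r (@lt_trans _ _ 1)// ?ltr1n//.
  by rewrite exprn_ilt1// ltW.
have [->|w0] := eqVneq w 0.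
  by rewrite push_zero !N0 mul0r !mulr0.
pose y := f x; pose v_ k := fpush k y (A x v); pose w_ k := fpush k y w.
have wk k' : 0 < N (iter k' f y) (w_ k').
  by rewrite N_gt0//; apply: contra_neq w0; exact: push_inj.
pose r k := N (iter k f y) (v_ k) / N (iter k f y) (w_ k).
have r0 k' : 0 <= r k' by rewrite divr_ge0 ?N_ge0.
have rE k' : r k' * N (iter k' f y) (w_ k') = N (iter k' f y) (v_ k').
  by rewrite /r divfK// gt_eqF.
pose S k := \sum_(i < k.+1) r i.
have SS k' : S k'.+1 = S k' + r k'.+1 by rewrite /S big_ord_recr.
have S_ge0 k' : 0 <= S k' by apply: sumr_ge0.
have Kwk k' t : avoids (iter k' f y) (t *: w_ k').
  by apply: avoidsZ; apply: (avoids_push k' y w).1.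
have seg k' : forall t, `|t| <= eps ^+ 2 * S k' ->
  C (iter k' f y) (v_ k' + t *: w_ k').
  elim: k' => [t|k' IH t].
    rewrite /S big_ord1 => Ht; apply: (C_open Cv) => /=.
    rewrite addrAC subrr add0r NZ.
    apply: (@le_trans _ _ (eps ^+ 2 * r 0%N * N y w));
      first by rewrite ler_wpM2r ?N_ge0.
    rewrite -mulrA (rE 0%N) expr2 -mulrA ler_wpM2l ?(ltW eps_gt0)//.
    by rewrite ler_piMl ?N_ge0// ltW.
  rewrite SS => Ht.
  pose a := eps ^+ 2 * S k'; pose b := eps ^+ 2 * r k'.+1.
  have a0 : 0 <= a by rewrite mulr_ge0 ?exprn_ge0// ltW.
  have b0 : 0 <= b by rewrite mulr_ge0 ?exprn_ge0// ltW.
  have {Ht} tab : `|t| <= a + b by rewrite -mulrDr.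
  (* Truncate [t] to the previous segment: [t'] is covered by the induction hypothesis, and the
     excess [d] is a perturbation made after applying [A]. *)
  have [t' [d [-> Ht' Hd]]] : exists t' d,
    [/\ t = t' + d, `|t'| <= a & `|d| <= b].
    have [ta|ta] := leP `|t| a.
      by exists t, 0; split => //; rewrite ?addr0 ?normr0.
    exists (Num.sg t * a), (Num.sg t * (`|t| - a)); split.
    - by rewrite -mulrDr addrC subrK mulr_sg_norm.
    - by rewrite normrM normr_sg (ger0_norm a0); case: (t != 0);
      rewrite ?mul0r ?mul1r.
    - rewrite normrM normr_sg.
      have : `| `|t| - a| <= b
        by rewrite ger0_norm ?subr_ge0 ?(ltW ta)// lerBlDl.
      by case: (t != 0); rewrite ?mul0r ?mul1r.
  have Cz := IH _ Ht'.
  apply: (C_open Cz) => /=.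
  have -> : A (iter k' f y) (v_ k' + t' *: w_ k') = v_ k'.+1 + t' *: w_ k'.+1.
    by rewrite addrC Alin addrC.
  rewrite opprD addrACA subrr add0r -scalerBl addrAC subrr add0r NZ.
  (* The perturbation has size at most [eps ^+ 2] times the norm of [v_ k'.+1]. One factor [eps] is
     spent here, to compare [v_ k'.+1] with [v_ k'.+1 + t' *: w_ k'.+1]; the other is the one in
     [C_open]. *)
  have := angle_cone (C_push k' (C_step Cv)) (Kwk k'.+1 t') => /= le1.
  apply: le_trans (ler_wpM2l (ltW eps_gt0) le1).
  apply: (@le_trans _ _ (b * N (iter k'.+1 f y) (w_ k'.+1))).
    by rewrite ler_wpM2r ?N_ge0.
  by rewrite /b -mulrA rE expr2 mulrA.
(* Take the endpoint [t] of the segment and cancel [t *: w_ k'.+1] after one step: [angle_avoids]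
   bounds [eps * t] by twice [r k'.+1], which is where [eps ^+ 3 / 2] comes from. *)
have upper k' : kappa * S k' <= r k'.+1.
  pose t := eps ^+ 2 * S k'.
  have t0 : 0 <= t by rewrite mulr_ge0 ?exprn_ge0// ltW.
  have /seg Cz : `|t| <= eps ^+ 2 * S k' by rewrite ger0_norm.
  have := angle_avoids Cz (Kwk k'.+1 (- t)).
  have -> : A (iter k' f y) (v_ k' + t *: w_ k') = v_ k'.+1 + t *: w_ k'.+1.
    by rewrite addrC Alin addrC.
  rewrite -/(iter k'.+1 f y) scaleNr addrK NN NZ ger0_norm// -rE => H.
  rewrite -(ler_pM2r (wk k'.+1)) /kappa.
  by rewrite -(ler_pM2l (_ : 0 < 2 :> R))// (le_trans _ H)// /t; lra.
have grow k' : (1 + kappa) ^+ k' * r 0%N <= S k'.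
  elim: k' => [|k' IH]; first by rewrite mul1r /S big_ord1.
  rewrite SS exprS -mulrA (@le_trans _ _ ((1 + kappa) * S k'))//.
    by rewrite ler_wpM2l// addr_ge0// ltW.
  by rewrite mulrDl mul1r lerD2l.
(* The factor [1 + kappa] on the right absorbs the index shift between [S k] and [r k.+1]. *)
have final : kappa * (1 + kappa) ^+ k * r 0%N <= (1 + kappa) * r k.
  case: k => [|k].
    by rewrite mulr1 ler_wpM2r// lerDr.
  rewrite exprS (mulrCA kappa) -(mulrA (1 + kappa)) -(mulrA kappa).
  rewrite ler_wpM2l ?addr_ge0 ?(ltW k0)//.
  by apply: le_trans (upper k); rewrite ler_wpM2l// ltW.
have := ler_wpM2r (ltW (mulr_gt0 (wk k) (wk 0%N))) final.
move: final (rE k) (rE 0%N); rewrite /v_ /w_ /= -/y => _ <- <-.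
move: (N _ (fpush k y w)) (N y w) (r k) (r 0%N) ((1 + kappa) ^+ k) => a b c d e.
suff [-> ->] : kappa * e * (a * (d * b)) = kappa * e * d * (a * b) /\
  (1 + kappa) * (c * a * b) = (1 + kappa) * c * (a * b) by [].
by move: (kappa) => t; split; ring.
Qed.

Variables (g : T -> T) (B : T -> V -> V).
Hypothesis Blin : forall x a v w, B x (a *: v + w) = a *: B x v + B x w.
Hypothesis gK : cancel g f.
Hypothesis BK : forall x v, A (g x) (B x v) = v.

Lemma iter_cancel k x : iter k f (iter k g x) = x.
Proof. by elim: k x => // k IH x; rewrite iterSr gK IH. Qed.

Lemma push_cancel k x v : fpush k (iter k g x) (push g B k x v) = v.
Proof. by elim: k => // k IH; rewrite pushSr /= BK gK. Qed.

Definition trapped (x : T) (v : V) : Prop :=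
  forall k, C (iter k g x) (push g B k x v).

Lemma trapped_avoids_eq0 x v w : trapped x v -> avoids x w -> v = w -> v = 0.
Proof. by move=> /(_ 0%N)/= Cv /(_ 0%N)/= Kw vw; rewrite vw Kw// -vw. Qed.

Lemma avoids_back k x w : avoids x w -> avoids (iter k g x) (push g B k x w).
Proof.
by move=> Kw; apply/(avoids_push k); rewrite iter_cancel push_cancel.
Qed.

Lemma kappa_gt0 : 0 < kappa.
Proof. by rewrite divr_gt0// exprn_gt0. Qed.

(** [cone_domination] speaks of the image of a cone vector; time 1 of the backward orbit of [v]
    provides the preimage. *)
Lemma trapped_domination x v w k : trapped x v -> avoids x w ->
  kappa * (1 + kappa) ^+ k * (N (iter k f x) (fpush k x w) * N x v) <=
  (1 + kappa) * (N (iter k f x) (fpush k x v) * N x w).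
Proof.
move=> /(_ 1%N)/= Cv Kw.
have := @cone_domination (g x) (B x v) w k Cv.
by rewrite gK BK; apply.
Qed.

Lemma trapped_back k x v : trapped x v -> trapped (iter k g x) (push g B k x v).
Proof. by move=> Ev j; rewrite -iterD -push_addn; exact: Ev. Qed.

(** Going [k] steps backward, [b] becomes exponentially long relative to trapped vectors. But
    [b = v - a] is a difference of two of them, so its pullback is no longer than the sum of theirs.
    Hence [(1 + kappa) ^+ k * N x b] stays bounded in [k]. This yields linearity of the set of
    trapped vectors although the cones are not convex. *)
Lemma trapped_split x v a b : trapped x v -> trapped x a -> avoids x b ->
  v = a + b -> b = 0.
Proof.
move=> Ev Ea Kb vab; apply/eqP/negP => /negP b0.
have k0 := kappa_gt0.
suff : kappa * N x b <= 0.
  by apply/negP; rewrite -ltNge mulr_gt0// N_gt0.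
apply: (@geometric_bound _ kappa _ ((1 + kappa) * (N x a + N x v))) => // k.
pose p u := push g B k x u; pose n u := N (iter k g x) (p u).
have H u : trapped x u ->
  kappa * (1 + kappa) ^+ k * (N x b * n u) <= (1 + kappa) * (N x u * n b).
  move=> Eu; have := trapped_domination k (trapped_back k Eu)
    (avoids_back (k := k) Kb).
  by rewrite iter_cancel !push_cancel.
have nb0 : 0 < n b.
  apply: N_gt0; apply: contra_neq b0 => pb.
  by rewrite -[b](push_cancel k x) -/(p b) pb push_zero.
have nb : n b <= n a + n v.
  have -> : n b = N (iter k g x) (- p a + p v).
    by rewrite /n /p vab (push_addv _ Blin) addrA addNr add0r.
  by apply: le_trans (ND _ _ _) _; rewrite NN.
rewrite -(ler_pM2r nb0); have := lerD (H a Ea) (H v Ev);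
  rewrite -!mulrDr -mulrDl.
move=> H1; rewrite -[leRHS]mulrA; apply: le_trans H1.
rewrite (mulrCA _ kappa) -mulrA -(mulrA _ (N x b)) (mulrA kappa).
rewrite ler_wpM2l//; first by apply: mulr_ge0 (ltW k0)
  (exprn_ge0 _ (addr_ge0 ler01 (ltW k0))).
by rewrite ler_wpM2l ?N_ge0.
Qed.

(** The forward counterpart of [trapped_split]: [a = w - b] would outgrow both avoiding vectors
    exponentially. *)
Lemma avoids_split x w a b : avoids x w -> trapped x a -> avoids x b ->
  w = a + b -> a = 0.
Proof.
move=> Kw Ea Kb wab; apply/eqP/negP => /negP a0.
have k0 := kappa_gt0.
suff : kappa * N x a <= 0.
  by apply/negP; rewrite -ltNge mulr_gt0// N_gt0.
apply: (@geometric_bound _ kappa _ ((1 + kappa) * (N x b + N x w))) => // k.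
pose n u := N (iter k f x) (fpush k x u).
have H u : avoids x u ->
  kappa * (1 + kappa) ^+ k * (n u * N x a) <= (1 + kappa) * (n a * N x u).
  by move=> Ku; have := trapped_domination k Ea Ku.
have na0 : 0 < n a by apply: N_gt0; apply: contra_neq a0; exact: push_inj.
have na : n a <= n b + n w.
  have -> : n a = N (iter k f x) (- fpush k x b + fpush k x w).
    by rewrite /n wab (push_addv _ Alin) addrCA addNr addr0.
  by apply: le_trans (ND _ _ _) _; rewrite NN.
rewrite -(ler_pM2r na0); have := lerD (H b Kb) (H w Kw);
  rewrite -!mulrDr -mulrDl.
move=> H1; rewrite -[leRHS]mulrA [X in _ <= _ * X]mulrC; apply: le_trans H1.
rewrite (mulrCA _ kappa) -mulrA -(mulrA _ (N x a)) (mulrA kappa).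
rewrite ler_wpM2l//; first by apply: mulr_ge0 (ltW k0)
  (exprn_ge0 _ (addr_ge0 ler01 (ltW k0))).
by rewrite mulrC ler_wpM2r ?N_ge0.
Qed.

End Cocycle.

(** * Limits of subspaces *)

Lemma cvg_sumr (R : realType) (V : normedModType R) (T I : Type)
    (F : set_system T) {FF : Filter F} (r : seq I) (h : I -> T -> V)
      (l : I -> V) :
  (forall i, h i x @[x --> F] --> l i) ->
  \sum_(i <- r) h i x @[x --> F] --> \sum_(i <- r) l i.
Proof.
move=> hl; apply: (@cvg_big V I +%R 0 predT) => //.
exact: add_continuous.
Qed.

Lemma row_linear_continuous (R : realType) (n : nat) (W : normedModType R)
  (f : 'rV[R]_n -> W) : linear f -> continuous f.
Proof.
move=> lf x; pose F : {linear 'rV[R]_n -> W} :=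
  HB.pack f (GRing.isLinear.Build R 'rV[R]_n W *:%R f lf).
have [c fE] : exists c, forall y, f y = \sum_(i < n) y 0 i *: c i.
  exists (fun i => f 'e_i) => y;
    rewrite -[f y]/(F y) {1}[y]row_sum_delta linear_sum.
  by apply: eq_bigr => i _; rewrite linearZ.
rewrite /continuous_at fE (funext fE).
apply: (@cvg_sumr _ _ _ _ _ (nbhs_filter x)) => i; apply: cvgZr_tmp.
exact: coord_continuous.
Qed.

(** Gram-Schmidt: normalise one nonzero row and recurse in its orthogonal complement inside [W],
    whose rank drops by at most one because [W *m v'^T] has a single column. *)
Lemma orthonormal_rows (R : rcfType) (n d m : nat) (W : 'M[R]_(m, n)) :
  (d <= \rank W)%N -> exists P : 'M[R]_(d, n), (P <= W)%MS /\ P *m P^T = 1%:M.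
Proof.
elim: d m W => [|d IH] m W dW.
  by exists 0; split; [exact: sub0mx | apply/matrixP => -[]].
have W0 : W != 0 by rewrite -mxrank_eq0 -lt0n (leq_trans _ dW).
pose v := nz_row W; pose a := (v *m v^T) 0 0.
have a0 : 0 < a.
  have sq_ge0 (i : 'I_n) : true -> 0 <= v 0 i * v^T i 0
    by rewrite mxE -expr2 sqr_ge0.
  rewrite /a mxE lt_def sumr_ge0// andbT;
    apply: contraNN W0 => /eqP /(psumr_eq0P sq_ge0) v0.
  rewrite -nz_row_eq0; apply/eqP/rowP => i; rewrite mxE; apply/eqP.
  by rewrite -sqrf_eq0 expr2; have := v0 i isT; rewrite mxE => ->.
pose v' := (Num.sqrt a)^-1 *: v.
have v'1 : v' *m v'^T = 1%:M.
  rewrite /v' linearZ /= -scalemxAl -scalemxAr scalerA.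
  rewrite [v *m _]mx11_scalar -/a -invfM -expr2 sqr_sqrtr ?ltW//.
  by rewrite scale_scalar_mx mulVf// gt_eqF.
have [|P' [P'W P'1]] := IH n (W :&: kermx v'^T)%MS.
  have := mxrank_mul_ker W v'^T => H.
  move: dW; rewrite -H; have := rank_leq_col (W *m v'^T).
  by case: (\rank (W *m v'^T)) => [|[|//]] _ //; rewrite add0n => /ltnW.
have [P'W1 /sub_kermxP P'v] : (P' <= W)%MS /\ (P' <= kermx v'^T)%MS.
  by move: P'W; rewrite sub_capmx => /andP[].
suff [QW Q1] : (col_mx v' P' <= W)%MS /\
    col_mx v' P' *m (col_mx v' P')^T = 1%:M by exists (col_mx v' P').
split; first by rewrite col_mx_sub P'W1 andbT scalemx_sub// nz_row_sub.
rewrite tr_col_mx mul_col_row P'v v'1 P'1.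
have -> : v' *m P'^T = 0 by rewrite -[LHS]trmxK trmx_mul trmxK P'v trmx0.
by rewrite -scalar_mx_block.
Qed.

Lemma vspace_orthonormal_rows (R : rcfType) (n : nat) (W : {vspace 'rV[R]_n}) :
  exists P : 'M[R]_(\dim W, n), (forall a, a *m P \in W) /\ P *m P^T = 1%:M.
Proof.
pose M := \matrix_(i < \dim W) (vbasis W)`_i.
have ME a : a *m M = \sum_i a 0 i *: (vbasis W)`_i.
  by rewrite mulmx_sum_row; apply: eq_bigr => i _; rewrite rowK.
have /orthonormal_rows[P [/submxP[D ->] P1]] : (\dim W <= \rank M)%N.
  suff /eqP -> : row_free M by [].
  apply: inj_row_free => a; rewrite ME => a0; apply/rowP => i; rewrite mxE.
  by move: i; apply/freeP: a0; exact: basis_free (vbasisP W).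
exists (D *m M); split=> // a; rewrite mulmxA ME.
by apply: memv_suml => i _; rewrite memvZ// vbasis_mem// memt_nth.
Qed.

Lemma vspace_of_rows (R : rcfType) (n d : nat) (P : 'M[R]_(d, n)) :
  P *m P^T = 1%:M -> exists2 W : {vspace 'rV[R]_n},
    \dim W = d & forall v, v \in W -> exists a, v = a *m P.
Proof.
move=> P1; pose L := linfun (mulmxr P : 'rV[R]_d -> 'rV[R]_n).
exists (limg L); last by move=> v /memv_imgP[a _ ->]; exists a; rewrite lfunE.
rewrite limg_dim_eq; first by rewrite dimvf dim_matrix; exact: mul1n.
apply/eqP; rewrite -subv0; apply/subvP => a /memv_capP[_].
rewrite memv_ker lfunE /= memv0 => /eqP aP.
by rewrite -[a]mulmx1 -P1 mulmxA aP mul0mx.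
Qed.

(* Subspaces are represented by orthonormal frames, which form a compact set. *)
Lemma nested_subspace (R : realType) (n d : nat) (C : nat -> set 'rV[R]_n) :
  (forall k, closed (C k)) -> (forall k, C k.+1 `<=` C k) ->
  (forall k, exists2 W : {vspace 'rV[R]_n}, [set` W] `<=` C k & \dim W = d) ->
  exists2 W : {vspace 'rV[R]_n}, (forall k, [set` W] `<=` C k) & \dim W = d.
Proof.
move=> Ccl Cdec CW.
pose Z k (P : 'M[R]_(d, n)) := P *m P^T = 1%:M /\ forall a, C k (a *m P).
have /choice[P ZP] k : exists P, Z k P.
  have [W WC dW] := CW k; have := vspace_orthonormal_rows W;
    rewrite dW => -[P [PW P1]].
  by exists P; split=> // a; apply: WC; exact: PW.
have Zdec j k : (k <= j)%N -> C j `<=` C k.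
  move=> /subnK <-; elim: (j - k)%N => //= i IH v.
  by rewrite addSn => /Cdec /IH.
pose p k := mxvec (P k).
(* Rows of unit length have entries in [[-1, 1]], so the flattened frames stay in this compact
   cube. *)
pose K := [set q : 'rV[R]_(d * n) | forall i, `[-1, 1]%classic (q 0 i)].
have Kco : compact K by exact:
  (@rV_compact R _ (fun=> `[-1, 1]%classic) (fun=> @segment_compact R (-1) 1)).
have pK k : K (p k).
  move=> i; rewrite /p; case/mxvec_indexP: i => i j; rewrite mxvecE.
  have [/matrixP/(_ i i) + _] := ZP k;
    rewrite !mxE eqxx (bigD1 j)//= mxE -expr2 => H.
  rewrite /= in_itv /= -ler_norml -(@ler_pXn2r _ 2)// ?nnegrE// expr1n.
  rewrite -normrX ger0_norm ?sqr_ge0// -[leRHS]H lerDl sumr_ge0// => l _.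
  by rewrite mxE -expr2 sqr_ge0.
have [q [_ qcl]] : K `&` cluster (p @ \oo) !=set0.
  by apply: Kco; exists 0%N => // k _; exact: pK.
have cvec a : continuous (fun r : 'rV[R]_(d * n) => a *m vec_mx r : 'rV[R]_n).
  apply: row_linear_continuous => b r r'.
  by rewrite linearP /= mulmxDr scalemxAr.
have qZ k : Z k (vec_mx q).
  have Fp : (p @ \oo) [set r | Z k (vec_mx r)].
    by exists k => // j /= kj; rewrite /p mxvecK; have [? ZC] := ZP j;
      split=> // a; exact/(Zdec _ _ kj).
  (* The frames of index at least [k] all satisfy [Z k], so every closed consequence of [Z k] passes
     to the cluster point [q]. *)
  have clZ B : closed B -> (forall r, Z k (vec_mx r) -> B r) -> B q.
    move=> Bcl ZB; rewrite (closure_id B).1// => U /(qcl _ _ Fp) [r [Zr Ur]].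
    by exists r; split=> //; exact: ZB.
  split; last first.
    move=> a; apply: (clZ ((fun r => a *m vec_mx r) @^-1` C k));
      last by move=> r [_]; exact.
    apply: preimage_closed => // r _; exact: cvec.
  apply/matrixP => i j.
  apply: (clZ [set r | (vec_mx r *m (vec_mx r)^T) i j = 1%:M i j]);
    last by move=> r [/= ->].
  have -> : [set r : 'rV[R]_(d * n) | (vec_mx r *m (vec_mx r)^T) i j =
    (1%:M : 'M[R]_d) i j] =
    (fun r => \sum_k r 0 (mxvec_index i k) * r 0 (mxvec_index j k)) @^-1`
      [set (1%:M : 'M[R]_d) i j].
    by apply/funext => r /=; rewrite mxE; congr (_ = _); apply: eq_bigr => l _;
      rewrite !mxE.
  apply: preimage_closed; last exact: closed_eq.
  move=> r _; apply: (@cvg_sumr _ _ _ _ _ (nbhs_filter r)) => l; apply: cvgM;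
    exact: coord_continuous.
have [W dW WP] := vspace_of_rows (qZ 0%N).1.
exists W => // k v /= /WP[a ->]; exact: (qZ k).2.
Qed.

(** * Limits of pairs and derivatives of C^1 maps *)

Lemma cvg_to_pair (T : Type) (X Y : topologicalType) (F : set_system T)
  {FF : Filter F} (h : T -> X) (k : T -> Y) (x : X) (y : Y) :
  h @ F --> x -> k @ F --> y -> (fun t => (h t, k t)) @ F --> (x, y).
Proof. by move=> hx ky; exact: (@cvg_pair _ _ _ F (nbhs x) (nbhs y)). Qed.

Lemma fst_cvg (X Y : topologicalType) (x : X) (y : Y) : fst @ (x, y) --> x.
Proof. exact: cvg_fst. Qed.

Lemma snd_cvg (X Y : topologicalType) (x : X) (y : Y) : snd @ (x, y) --> y.
Proof. exact: cvg_snd. Qed.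

(** Identities such as [coordK] hold only on chart domains, hence only near a point; this allows
    them to be differentiated. *)
Lemma diff_near_eq (R : realType) (V W : normedModType R) (h k : V -> W) (x : V)
  :
  differentiable h x -> (\forall y \near x, h y = k y) ->
  differentiable k x /\ 'd k x = 'd h x :> (V -> W).
Proof.
move=> dh hk; have dc := diff_continuous dh.
have kE : k \o shift x = cst (k x) + 'd h x +o_ 0 id.
  apply/eqaddoP => e e0.
  have /eqaddoP/(_ e e0) := diff_locally dh.
  have : \forall y \near 0, h (y + x) = k (y + x).
    have /= := @near_shift _ _ 0 x (fun y => h y = k y).
    by rewrite subr0 => <-.
  have hkx : h x = k x := nbhs_singleton hk.
  apply: filterS2 => y /= hky.
  by rewrite !fctE /= /shift hky hkx.
have dE := diff_unique dc kE; split => //.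
by apply/diff_locallyP; rewrite dE.
Qed.

Definition C1_at (R : realType) (V W : normedModType R) (h : V -> W) (x : V) :=
  (\forall y \near x, differentiable h y) /\
  forall v, {for x, continuous (fun y => 'D_v h y)}.

Lemma Ck1_C1_at (R : realType) (V W : normedModType R) (U : set V) (h : V -> W)
  (x : V) : nbhs x U -> Ck 1 U h -> C1_at h x.
Proof.
move=> NU [dh ch]; split=> [|v]; first exact: filterS NU.
exact: ch (nbhs_singleton NU).
Qed.

Lemma C1_at_diff (R : realType) (V W : normedModType R) (h : V -> W) (x : V) :
  C1_at h x -> differentiable h x.
Proof. by case=> /nbhs_singleton. Qed.

(** Expanding the vector in the canonical basis reduces joint continuity to that of finitely many
    partial derivatives. *)
Lemma diff_joint_cvg (R : realType) (n : nat) (W : normedModType R)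
  (h : 'rV[R]_n -> W) (x v : 'rV[R]_n) : C1_at h x ->
  'd h (z.1) (z.2) @[z --> (x, v)] --> 'd h x v.
Proof.
move=> [dh ch].
have dE y w : differentiable h y ->
  'd h y w = \sum_(i < n) w 0 i *: 'D_('e_i) h y.
  move=> dhy; rewrite {1}[w]row_sum_delta linear_sum; apply: eq_bigr => i _.
  by rewrite linearZ deriveE.
have key : (fun z : 'rV[R]_n * 'rV[R]_n =>
  \sum_(i < n) z.2 0 i *: 'D_('e_i) h z.1) @ (x, v) -->
    \sum_(i < n) v 0 i *: 'D_('e_i) h x.
  apply: cvg_sumr => i; apply: cvgZ.
    exact: (cvg_comp snd (fun w : 'rV[R]_n => w 0 i) cvg_snd
      (@coord_continuous _ _ _ 0 i v)).
  exact: (cvg_comp fst (fun y => 'D_('e_i) h y) cvg_fst (ch _)).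
move: key; rewrite -(dE x v (nbhs_singleton dh)).
apply: cvg_trans; apply: near_eq_cvg.
have : \forall z \near (x, v), differentiable h (z.1) by exact: cvg_fst dh.
by apply: filterS => z /dE ->.
Qed.

(** * The tangent bundle in charts *)

Section Tangent.
Context {R : realType} {n : nat} {M : closed_manifold R n}.
Local Notation V := 'rV[R]_n.
Implicit Types (a b c : chart M) (x y : M) (v w : V) (f g h : M -> M).

Lemma near_dom a x : dom a x -> \forall y \near x, dom a y.
Proof. by move=> ax; apply: open_nbhs_nbhs; split=> //; exact: open_dom. Qed.

Lemma near_icoord a x (P : M -> Prop) : dom a x ->
  (\forall y \near x, P y) -> \forall y \near Defs.coord a x, P (icoord a y).
Proof.
by move=> ax Px; apply: (icoord_continuous ax); rewrite coordK.
Qed.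

Lemma near_chart a x : dom a x ->
  \forall y \near Defs.coord a x,
    dom a (icoord a y) /\ Defs.coord a (icoord a y) = y.
Proof.
move=> ax; have : nbhs (Defs.coord a x) (Defs.coord a @` dom a).
  by apply: open_nbhs_nbhs; split; [exact: open_coord | exists x].
by apply: filterS => _ [y ay <-]; rewrite coordK.
Qed.

Lemma open_chart_image a (P : set M) : open P ->
  open (Defs.coord a @` (dom a `&` P)).
Proof.
move=> oP; rewrite openE => _ [x [ax Px] <-].
have := near_icoord ax (open_nbhs_nbhs (conj oP Px)).
rewrite /interior; apply: filterS2 (near_chart ax) => y [ay yE] Py.
by exists (icoord a y).
Qed.

Definition dchart f a b (x : M) : V -> V :=
  'd (Defs.coord b \o f \o icoord a) (Defs.coord a x).

Definition to_chart a x v := dchart id (chart_at x) a x v.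

Lemma of_chartE a x v : of_chart a x v = dchart id a (chart_at x) x v.
Proof. by []. Qed.

Lemma dchart_linear f a b x : linear (dchart f a b x).
Proof. by move=> r v w; rewrite /dchart linearP. Qed.

Lemma C1_map_id : C1_map (@id M).
Proof.
split=> [x|a b]; first by [].
have [dab cab] := transition_smooth a b 1%N.
exact: conj dab cab.
Qed.

Lemma C1_map_at f a b x : C1_map f -> dom a x -> dom b (f x) ->
  C1_at (Defs.coord b \o f \o icoord a) (Defs.coord a x).
Proof.
move=> [cf df] ax bfx; apply: Ck1_C1_at (df a b).
apply: open_nbhs_nbhs; split; last by exists x.
by apply: open_chart_image; apply: open_comp (open_dom b) => y _; exact: cf.
Qed.

Lemma dchart_comp f g a b c x v : C1_map f -> C1_map g ->
  dom a x -> dom b (f x) -> dom c (g (f x)) ->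
  dchart (g \o f) a c x v = dchart g b c (f x) (dchart f a b x v).
Proof.
move=> Cf Cg ax bfx cgfx.
have df := C1_at_diff (C1_map_at Cf ax bfx).
have dg := C1_at_diff (C1_map_at Cg bfx cgfx).
have yE : (Defs.coord b \o f \o icoord a) (Defs.coord a x) = Defs.coord b (f x).
  by rewrite /= coordK.
rewrite -yE in dg.
have dgf := differentiable_comp df dg.
have dcomp := diff_comp df dg.
have near_eq : \forall y \near Defs.coord a x,
    ((Defs.coord c \o g \o icoord b) \o (Defs.coord b \o f \o icoord a)) y =
    (Defs.coord c \o (g \o f) \o icoord a) y.
  have := near_icoord ax (Cf.1 x _ (near_dom bfx)).
  by apply: filterS => y /= bfy; rewrite coordK.
have [_ dE] := diff_near_eq dgf near_eq.
have at_eq p q w : p = q ->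
    'd (Defs.coord c \o g \o icoord b) p w =
      'd (Defs.coord c \o g \o icoord b) q w.
  by move=> ->.
apply: etrans (congr1 (fun F : V -> V => F v) dE) _.
apply: etrans (congr1 (fun F : V -> V => F v) dcomp) _.
exact: at_eq yE.
Qed.

Lemma dchart_id a x v : dom a x -> dchart id a a x v = v.
Proof.
move=> ax; rewrite /dchart.
have near_eq : \forall y \near Defs.coord a x,
  id y = (Defs.coord a \o id \o icoord a) y.
  by apply: filterS (near_chart ax) => y [_ /= ->].
have [idx idE] := is_diff_id (Defs.coord a x).
have [_ dE] := diff_near_eq idx near_eq.
apply: etrans (congr1 (fun F : V -> V => F v) dE) _.
exact: (congr1 (fun F : V -> V => F v) idE).
Qed.

Lemma of_chartK a x : dom a x -> cancel (of_chart a x) (to_chart a x).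
Proof.
move=> ax v; rewrite /to_chart of_chartE.
have cx := dom_chart_at x.
by rewrite -(@dchart_comp id id a (chart_at x) a x v C1_map_id C1_map_id)//
  dchart_id.
Qed.

Lemma to_chartK a x : dom a x -> cancel (to_chart a x) (of_chart a x).
Proof.
move=> ax v; rewrite /to_chart of_chartE.
have cx := dom_chart_at x.
by rewrite -(@dchart_comp id id _ a _ x v C1_map_id C1_map_id)// dchart_id.
Qed.

Lemma of_chart_at x v : of_chart (chart_at x) x v = v.
Proof. by rewrite of_chartE dchart_id//; exact: dom_chart_at. Qed.

Lemma of_chart_linear a x : linear (of_chart a x).
Proof. exact: dchart_linear. Qed.

Lemma to_chart_linear a x : linear (to_chart a x).
Proof. exact: dchart_linear. Qed.

Lemma tmap_linear f x : linear (tmap f x).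
Proof. exact: dchart_linear. Qed.

Lemma tmap_of_chart f a b x v : C1_map f -> dom a x -> dom b (f x) ->
  tmap f x (of_chart a x v) = of_chart b (f x) (dchart f a b x v).
Proof.
move=> Cf ax bfx; rewrite of_chartE [RHS]of_chartE.
have cx := dom_chart_at x; have cfx := dom_chart_at (f x).
rewrite -(@dchart_comp f id a b _ x v Cf C1_map_id)//.
by rewrite -[LHS](@dchart_comp id f a _ _ x v C1_map_id Cf).
Qed.

Lemma tmapK f h x v : C1_map f -> C1_map h -> cancel f h ->
  tmap h (f x) (tmap f x v) = v.
Proof.
move=> Cf Ch fK; rewrite -[RHS](dchart_id v (dom_chart_at x)).
have cx := dom_chart_at x; have cfx := dom_chart_at (f x).
have cx' : dom (chart_at (h (f x))) (h (f x)) by exact: dom_chart_at.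
have -> : dchart id (chart_at x) (chart_at x) x v =
          dchart (h \o f) (chart_at x) (chart_at (h (f x))) x v.
  have hf : h \o f = id by apply/funext => y; exact: fK.
  by rewrite hf fK.
by rewrite (@dchart_comp f h _ (chart_at (f x)) _ x v Cf Ch).
Qed.

Lemma dchart_cvg f a b x v : C1_map f -> dom a x -> dom b (f x) ->
  dchart f a b z.1 z.2 @[z --> (x, v)] --> dchart f a b x v.
Proof.
move=> Cf ax bfx.
have cv : (fun z : M * V => (Defs.coord a z.1, z.2)) @ (x, v) -->
  (Defs.coord a x, v).
  apply: cvg_to_pair; last exact: snd_cvg.
  exact: (cvg_comp _ _ (@fst_cvg M V x v) (Defs.coord_continuous ax)).
exact: (cvg_comp _ _ cv (diff_joint_cvg (v := v) (C1_map_at Cf ax bfx))).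
Qed.

(* The neighbourhood filter of (x, v) in TM, whose topology is not otherwise
   available because the preferred charts do not depend continuously on x. *)
Definition tnbhs (x : M) (v : V) : set_system (M * V) :=
  (fun z : M * V => (z.1, of_chart (chart_at x) z.1 z.2)) @ (x, v).

#[global] Instance tnbhs_filter x v : ProperFilter (tnbhs x v).
Proof. by apply: fmap_proper_filter. Qed.

Lemma tnbhs_singleton x v (P : M * V -> Prop) : tnbhs x v P -> P (x, v).
Proof. by move=> /nbhs_singleton; rewrite /= of_chart_at. Qed.

Lemma tnbhs_fst x v : fst @ tnbhs x v --> x.
Proof. by move=> P Px; exact: (@fst_cvg M V x v P Px). Qed.

(** [tmap f] is expressed in the preferred charts of the moving points, which need not vary
    continuously. Rewriting it through the two fixed charts [a] and [b] leaves only the continuous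
    map [dchart f a b]. *)
Lemma tmap_chart_cvg f a x v : C1_map f -> dom a x ->
  (f z.1, tmap f z.1 (of_chart a z.1 z.2)) @[z --> (x, v)] -->
  tnbhs (f x) (tmap f x (of_chart a x v)).
Proof.
move=> Cf ax P; set b := chart_at (f x) => NP.
have bfx : dom b (f x) := dom_chart_at _.
have near_ab : \forall z \near (x, v), dom a z.1 /\ dom b (f z.1).
  apply: (@fst_cvg M V x v (fun y => dom a y /\ dom b (f y))).
  by apply: filterI (near_dom ax) (Cf.1 x _ (near_dom bfx)).
have tE : tmap f x (of_chart a x v) = dchart f a b x v.
  by rewrite (tmap_of_chart _ Cf ax bfx) of_chart_at.
rewrite tE in NP.
have cv : (f z.1, dchart f a b z.1 z.2) @[z --> (x, v)] -->
  (f x, dchart f a b x v).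
  apply: cvg_to_pair; last exact: dchart_cvg.
  exact: (cvg_comp _ _ (@fst_cvg M V x v) (Cf.1 x)).
have := cv _ NP; apply: filterS2 near_ab => z [az bfz] /=.
by rewrite -(tmap_of_chart _ Cf az bfz).
Qed.

Lemma tmap_id x v : tmap id x v = v.
Proof. exact/dchart_id/dom_chart_at. Qed.

Lemma of_chart_cvg a x v : dom a x ->
  (z.1, of_chart a z.1 z.2) @[z --> (x, v)] --> tnbhs x (of_chart a x v).
Proof.
move=> ax; have := tmap_chart_cvg (v := v) C1_map_id ax; rewrite tmap_id.
by under eq_fun do rewrite tmap_id.
Qed.

Lemma tmap_cvg f x v : C1_map f ->
  (f z.1, tmap f z.1 z.2) @[z --> tnbhs x v] --> tnbhs (f x) (tmap f x v).
Proof.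
move=> Cf P NP; have := tmap_chart_cvg (v := v) Cf (dom_chart_at x).
by rewrite of_chart_at => /(_ P NP).
Qed.

Lemma to_chart_cvg a x v : dom a x ->
  to_chart a z.1 z.2 @[z --> tnbhs x v] --> to_chart a x v.
Proof.
move=> ax P NP; set c := chart_at x.
have cx : dom c x := dom_chart_at x.
have near_ca : \forall z \near (x, v), dom c z.1 /\ dom a z.1.
  apply: (@fst_cvg M V x v (fun y => dom c y /\ dom a y)).
  exact: filterI (near_dom cx) (near_dom ax).
have := dchart_cvg (v := v) C1_map_id cx ax NP.
rewrite /tnbhs -/c; apply: filterS2 near_ca => z [cz az] /=.
rewrite /to_chart of_chartE.
by rewrite -(@dchart_comp id id c (chart_at z.1) a z.1 _ C1_map_id C1_map_id)//;
  exact: dom_chart_at.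
Qed.

Lemma tnbhs_fibre x v (P : M * V -> Prop) : tnbhs x v P ->
  \forall w \near v, P (x, w).
Proof.
move=> NP; have cv : (fun w => (x, w)) @ nbhs v --> (x, v).
  by apply: (@cvg_to_pair V M V (nbhs v) _ (fun=> x) id) => //; exact: cvg_cst.
have H : \forall w \near v, P (x, of_chart (chart_at x) x w) := cv _ NP.
by apply: filterS H => w; rewrite of_chart_at.
Qed.

Definition tcontinuous (e : M -> V) x := (y, e y) @[y --> x] --> tnbhs x (e x).

Lemma tcontinuousP a (e : M -> V) x : dom a x ->
  tcontinuous e x <-> {for x, continuous (fun y => to_chart a y (e y))}.
Proof.
move=> ax; split=> [ce|ce].
  exact: (cvg_comp _ _ ce (to_chart_cvg ax)).
have := of_chart_cvg (v := to_chart a x (e x)) ax; rewrite to_chartK// => cv.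
have cp : (fun y => (y, to_chart a y (e y))) @ x --> (x, to_chart a x (e x)).
  exact: (@cvg_to_pair M M V (nbhs x) _ id _ _ _ cvg_id ce).
apply: cvg_trans (cvg_comp _ _ cp cv); apply: near_eq_cvg.
by apply: filterS (near_dom ax) => y ay /=; rewrite to_chartK.
Qed.

Lemma tcontinuous_of_chart a x v : dom a x ->
  tcontinuous (fun y => of_chart a y v) x.
Proof.
move=> ax; apply/(tcontinuousP _ ax); apply: cvg_near_cst.
by apply: filterS (near_dom ax) => y ay; rewrite !of_chartK.
Qed.

End Tangent.

(** * Compactness of the unit spheres of the tangent spaces *)

Section Sphere.
Context {R : realType} {n : nat} {M : closed_manifold R n}.
Local Notation V := 'rV[R]_n.

Lemma sphere_compact : compact [set v : V | `|v| = 1].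
Proof.
apply: bounded_closed_compact.
  by exists 1; split => // r r1 v /= ->; exact: ltW.
apply: (@preimage_closed V R (fun v => `|v|) [set 1]); last exact: closed_eq.
by move=> v _; exact: norm_continuous.
Qed.

(* Compactness of the unit sphere of T_xM in chart coordinates. *)
Lemma near_all_vectors (I : Type) (F : set_system I) {FF : Filter F}
    (P : I -> M -> V -> Prop) (x : M) :
  (forall i y a v, a != 0 -> P i y v -> P i y (a *: v)) ->
  (forall v, v != 0 ->
     filter_prod (tnbhs x v) F [set zi | P zi.2 zi.1.1 zi.1.2]) ->
  filter_prod (nbhs x) F [set yi | forall v, v != 0 -> P yi.2 yi.1 v].
Proof.
move=> PZ Ploc; pose c := chart_at x.
have near_c : filter_prod (nbhs x) F [set yi | dom c yi.1].
  by apply: cvg_fst; exact: near_dom (dom_chart_at x).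
have Hcov : filter_prod (nbhs x) F
  [set yi | [set v : V | `|v| = 1] `<=`
  (fun w => P yi.2 yi.1 (of_chart c yi.1 w))].
  apply: ((iffLR (compact_near_coveringP _) sphere_compact) _
    (filter_prod (nbhs x) F) (fun yi w => P yi.2 yi.1 (of_chart c yi.1 w))) =>
      w /= w1.
  have w0 : w != 0 by rewrite -normr_eq0 w1 oner_eq0.
  have [[A B] /= [NA FB] AB] := Ploc w w0.
  have [[A1 A2] /= [NA1 NA2] A12] := NA.
  exists (A2, A1 `*` B); first by split=> //; exists (A1, B).
  move=> [w' [y i]] /= [A2w' [A1y Bi]].
  by apply: (AB ((y, of_chart c y w'), i)); split=> //=; exact: (A12 (y, w')).
apply: filterS2 near_c Hcov => -[y i] /= cy H v v0.
pose w := to_chart c y v.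
have w0 : w != 0.
  by apply: contra_neq v0 => w0;
    rewrite -(to_chartK cy v) -/w w0 (linear_zero (of_chart_linear c y)).
have nw0 : `|w| != 0 by rewrite normr_eq0.
have := H (`|w|^-1 *: w) _;
  rewrite /= normrZ normfV normr_id mulVf// => /(_ erefl).
move=> /(PZ _ _ `|w| _ nw0).
by rewrite -(linear_scale (of_chart_linear c y)) scalerA mulfV// scale1r
  to_chartK.
Qed.

End Sphere.

(** * Metrics *)

Section Metric.
Context {R : realType} {n : nat} {M : closed_manifold R n}.
Local Notation V := 'rV[R]_n.
Variable g : M -> V -> V -> R.
Hypothesis g_ip : inner_products g.

Lemma inner_linear_l x w : linear (fun v => g x v w : R^o).
Proof. by move=> a v v'; exact: inner_linear. Qed.

Lemma inner_linear_r x w : linear (g x w : V -> R^o).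
Proof. by move=> a v v';
  rewrite inner_sym// (inner_linear g_ip) !(inner_sym g_ip x w). Qed.

Lemma inner_addl x v v' w : g x (v + v') w = g x v w + g x v' w.
Proof. exact: (linear_add (inner_linear_l x w)). Qed.

Lemma inner_addr x v v' w : g x w (v + v') = g x w v + g x w v'.
Proof. exact: (linear_add (inner_linear_r x w)). Qed.

Lemma inner_scalel x a v w : g x (a *: v) w = a * g x v w.
Proof. exact: (linear_scale (inner_linear_l x w)). Qed.

Lemma inner_scaler x a v w : g x w (a *: v) = a * g x w v.
Proof. exact: (linear_scale (inner_linear_r x w)). Qed.

Lemma inner_oppl x v w : g x (- v) w = - g x v w.
Proof. exact: (linear_opp (inner_linear_l x w)). Qed.

Lemma inner_oppr x v w : g x w (- v) = - g x w v.
Proof. exact: (linear_opp (inner_linear_r x w)). Qed.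

Lemma inner_zero x w : g x 0 w = 0.
Proof. exact: (linear_zero (inner_linear_l x w)). Qed.

Lemma inner_ge0 x v : 0 <= g x v v.
Proof.
have [->|v0] := eqVneq v 0; first by rewrite inner_zero.
exact/ltW/inner_pos.
Qed.

Lemma cauchy_schwarz x v w : g x v w ^+ 2 <= g x v v * g x w w.
Proof.
have [->|w0] := eqVneq w 0.
  by rewrite (inner_sym g_ip) !inner_zero expr0n mulr0.
have ww := inner_pos g_ip x w0.
have := inner_ge0 x (g x w w *: v - g x v w *: w).
rewrite !(inner_addl, inner_addr, inner_oppl, inner_oppr, inner_scalel,
  inner_scaler).
rewrite (inner_sym g_ip x w v) => H.
rewrite -subr_ge0 -(pmulr_rge0 _ ww).
by rewrite (le_trans H)// le_eqVlt; apply/orP; left; apply/eqP; ring.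
Qed.

Lemma tnorm_ge0 x v : 0 <= tnorm g x v.
Proof. exact: sqrtr_ge0. Qed.

Lemma sqr_tnorm x v : tnorm g x v ^+ 2 = g x v v.
Proof. by rewrite sqr_sqrtr// inner_ge0. Qed.

Lemma tnorm_scale x a v : tnorm g x (a *: v) = `|a| * tnorm g x v.
Proof.
by rewrite /tnorm inner_scalel inner_scaler mulrA -expr2 sqrtrM ?sqr_ge0//
  sqrtr_sqr.
Qed.

Lemma tnorm_gt0 x v : v != 0 -> 0 < tnorm g x v.
Proof. by move=> v0; rewrite sqrtr_gt0; exact: inner_pos. Qed.

Lemma tnorm_triangle x v w : tnorm g x (v + w) <= tnorm g x v + tnorm g x w.
Proof.
rewrite -(@ler_pXn2r _ 2)// ?nnegrE ?addr_ge0 ?tnorm_ge0//.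
rewrite sqrrD !sqr_tnorm !(inner_addl, inner_addr) (inner_sym g_ip x w v).
suff : g x v w <= tnorm g x v * tnorm g x w by lra.
apply: (le_trans (ler_norm _));
  rewrite -(@ler_pXn2r _ 2)// ?nnegrE ?mulr_ge0 ?tnorm_ge0//.
by rewrite exprMn !sqr_tnorm real_normK ?num_real// cauchy_schwarz.
Qed.

Hypothesis g_cont : metric_class 0 g.

Lemma metric_chart_cvg a x v w : dom a x ->
  {for x, continuous (fun y => g y (of_chart a y v) (of_chart a y w))}.
Proof.
move=> ax; have ux : (Defs.coord a @` dom a) (Defs.coord a x) by exists x.
have := @g_cont a v w _ ux; rewrite /prop_for /continuous_at /= coordK// => cg.
have := cvg_comp _ _ (Defs.coord_continuous ax) cg.
apply: cvg_trans; apply: near_eq_cvg.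
by apply: filterS (near_dom ax) => y ay /=; rewrite coordK.
Qed.

Lemma metric_cvg x v : g z.1 z.2 z.2 @[z --> tnbhs x v] --> g x v v.
Proof.
pose c := chart_at x; have cx : dom c x := dom_chart_at x.
pose G i j y := g y (of_chart c y 'e_i) (of_chart c y 'e_j).
have gE y w : g y (of_chart c y w) (of_chart c y w) =
    \sum_(i < n) \sum_(j < n) w 0 i * (w 0 j * G i j y).
  have ofE : of_chart c y w = \sum_(i < n) w 0 i *: of_chart c y 'e_i.
    pose L : {linear V -> V} := HB.pack (of_chart c y)
      (GRing.isLinear.Build R V V *:%R (of_chart c y) (of_chart_linear c y)).
    rewrite -[LHS]/(L w) {1}[w]row_sum_delta linear_sum.
    by apply: eq_bigr => i _; rewrite linearZ.
  rewrite {1}ofE (big_morph (fun u => g y u _) (id1 := 0) (op1 := +%R));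
    last first.
  - exact: inner_zero.
  - by move=> u u'; exact: inner_addl.
  apply: eq_bigr => i _; rewrite inner_scalel ofE -mulr_sumr; congr (_ * _).
  rewrite (big_morph (fun u => g y _ u) (id1 := 0) (op1 := +%R)); last first.
  - by rewrite (inner_sym g_ip) inner_zero.
  - by move=> u u'; exact: inner_addr.
  by apply: eq_bigr => j _; rewrite inner_scaler.
have -> : g x v v = \sum_(i < n) \sum_(j < n) v 0 i * (v 0 j * G i j x).
  by rewrite -gE of_chart_at.
suff : (fun z : M * V =>
  \sum_(i < n) \sum_(j < n) z.2 0 i * (z.2 0 j * G i j z.1)) @ (x, v) -->
    \sum_(i < n) \sum_(j < n) v 0 i * (v 0 j * G i j x).
  by under eq_fun do rewrite -gE.
have cfst i j : (fun z : M * V => G i j z.1) @ (x, v) --> G i j x.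
  have H : G i j @ x --> G i j x := @metric_chart_cvg c x 'e_i 'e_j cx.
  exact: (cvg_comp fst (G i j) (@fst_cvg M V x v) H).
have csnd i : (fun z : M * V => z.2 0 i) @ (x, v) --> v 0 i.
  exact: (cvg_comp snd (fun w : 'rV[R]_n => w 0 i) (@snd_cvg _ _ x v)
    (@coord_continuous _ _ _ 0 i v)).
apply: (@cvg_sumr R R^o) => i; apply: (@cvg_sumr R R^o) => j.
by apply: cvgM (csnd i) _; exact: cvgM (csnd j) (cfst i j).
Qed.

Lemma tnorm_cvg x v : tnorm g z.1 z.2 @[z --> tnbhs x v] --> tnorm g x v.
Proof. exact: (cvg_comp _ _ (@metric_cvg x v) (@sqrt_continuous R _)). Qed.

End Metric.

(** * Uniform constants over the unit tangent bundle *)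

Section Compactness.
Context {R : realType} {n : nat} {M : closed_manifold R n}.
Local Notation V := 'rV[R]_n.

Lemma near_all_points (I : Type) (F : set_system I) {FF : Filter F}
  (Q : I -> M -> Prop) :
  (forall x : M, filter_prod (nbhs x) F [set yi : M * I | Q yi.2 yi.1]) ->
  \forall i \near F, forall x, Q i x.
Proof.
move=> H; have cov := iffLR (compact_near_coveringP _) (@carrier_compact R n M).
have FQ : F [set i | [set: M] `<=` Q i] := cov _ F Q FF (fun x _ => H x).
by apply: filterS FQ => i Qi x; exact: Qi.
Qed.

(** Typically [F] is [0^'+] and [i] a constant to be chosen small: homogeneity and compactness of
    the unit tangent bundle turn local choices of the constant into a global one. *)
Lemma near_everywhere (I : Type) (F : set_system I) {FF : Filter F}
  (P : I -> M -> V -> Prop) :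
  (forall i y a v, a != 0 -> P i y v -> P i y (a *: v)) ->
  (forall x v, v != 0 ->
    filter_prod (tnbhs x v) F [set zi : M * V * I | P zi.2 zi.1.1 zi.1.2]) ->
  \forall i \near F, forall x v, v != 0 -> P i x v.
Proof.
move=> PZ Ploc; apply: near_all_points => x.
by apply: (@near_all_vectors R n M I F FF P x) => // v; exact: Ploc.
Qed.

Lemma near_vectors (P : M -> V -> Prop) (x : M) :
  (forall y a v, a != 0 -> P y v -> P y (a *: v)) ->
  (forall v, v != 0 -> tnbhs x v [set z : M * V | P z.1 z.2]) ->
  \forall y \near x, forall v, v != 0 -> P y v.
Proof.
move=> PZ Ploc.
have [| |[A B] /= [NA NB] AB] :=
  @near_all_vectors R n M unit (globally setT) _ (fun _ => P) x.
- by move=> _; exact: PZ.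
- move=> v v0; exists ([set z : M * V | P z.1 z.2], setT).
    by split; [exact: Ploc|].
  by move=> [z []] [].
- by apply: filterS NA => y Ay; exact: (AB (y, tt) (conj Ay (NB tt I))).
Qed.

Variable g : M -> V -> V -> R.
Hypothesis g_ip : inner_products g.
Hypothesis g_cont : metric_class 0 g.

(** The local input for comparing a continuous function with a norm: near a nonzero vector the norm
    stays away from 0, so a small multiple of the function stays below it. *)
Lemma pos_near_scale (T : Type) (F : set_system T) {FF : Filter F}
  (h k : T -> R) (a b : R) :
  h @ F --> a -> k @ F --> b -> 0 < b ->
  filter_prod F (0^'+) [set ti : T * R | ti.2 * h ti.1 <= k ti.1].
Proof.
move=> ha kb b0.
have nh : \forall t \near F, h t < `|a| + 1.
  have := cvgr_lt a ha; apply; by rewrite (le_lt_trans (ler_norm a))// ltrDl.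
have nk : \forall t \near F, b / 2 < k t.
  by have := cvgr_gt b kb; apply; rewrite ltr_pdivrMr// mulr_natr mulr2n ltrDl.
pose r := (b / 2) / (`|a| + 1).
have a1 : 0 < `|a| + 1 by rewrite ltr_wpDl.
have r0 : 0 < r by rewrite !divr_gt0.
exists ([set t | h t < `|a| + 1 /\ b / 2 < k t], [set e | 0 < e /\ e < r]).
  split=> /=; first exact: filterI.
  by apply: filterI; [exact: nbhs_right_gt | exact: nbhs_right_lt].
move=> [t e] /= [[ht kt] [e0 er]]; apply: le_trans (ltW kt).
have [h0|h0] := leP (h t) 0.
  by rewrite (@le_trans _ _ 0)// ?divr_ge0 ?(ltW b0)// pmulr_rle0.
by rewrite -ler_pdivlMr// (le_trans (ltW er))// ler_wpM2l ?divr_ge0 ?(ltW b0)//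
  lef_pV2// ltW.
Qed.

Lemma chart_norm_le (c : chart M) (x : M) : dom c x ->
  exists2 d, 0 < d & \forall y \near x, forall v,
    d * `|to_chart c y v| <= tnorm g y v.
Proof.
move=> cx.
have : filter_prod (nbhs x) (0^'+) [set yi : M * R | forall v, v != 0 ->
    yi.2 * `|to_chart c yi.1 v| <= tnorm g yi.1 v].
  apply: (@near_all_vectors R n M R (0^'+) _
    (fun d y v => d * `|to_chart c y v| <= tnorm g y v)).
    move=> d y a v a0 H; rewrite (linear_scale (to_chart_linear c y)) normrZ.
    by rewrite tnorm_scale// mulrCA ler_wpM2l.
  move=> v v0; have hc : (fun z : M * V => `|to_chart c z.1 z.2|) @ tnbhs x v
    --> `|to_chart c x v|.
    apply: (cvg_comp (fun z : M * V => to_chart c z.1 z.2) (fun w : V => `|w|)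
      (to_chart_cvg (v := v) cx)); exact: norm_continuous.
  exact: (pos_near_scale hc (tnorm_cvg g_ip g_cont (x := x) (v := v))
    (tnorm_gt0 g_ip x v0)).
move=> [[A B] /= [NA NB] AB].
have [d [Bd d0]] : exists d, B d /\ 0 < d.
  by apply: (@filter_ex _ (0^'+)); apply: filterI NB (nbhs_right_gt _).
exists d => //; apply: filterS NA => y Ay v.
have [->|v0] := eqVneq v 0; last exact: (AB (y, d) (conj Ay Bd)).
by rewrite (linear_zero (to_chart_linear c y)) normr0 mulr0 tnorm_ge0.
Qed.

(** The fibre balls are centred at all vectors near [v] and share one radius. [chart_norm_le]
    converts metric distance into coordinate distance; half of the coordinate radius is reserved for
    moving the centre. *)
Lemma tnbhs_ball (x : M) (v : V) (P : M * V -> Prop) : tnbhs x v P ->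
  exists2 r, 0 < r & tnbhs x v
    [set z : M * V | forall w, tnorm g z.1 (w - z.2) < r -> P (z.1, w)].
Proof.
move=> NP; pose c := chart_at x; have cx : dom c x := dom_chart_at x.
have [d d0 Hd] := chart_norm_le cx.
have [[A B] /= [NA /nbhs_ballP[r r0 rB]] AB] := NP.
exists (d * (r / 2)); first by rewrite mulr_gt0// divr_gt0.
have r20 : 0 < r / 2 by rewrite divr_gt0.
exists ([set y | A y /\ (forall v, d * `|to_chart c y v| <= tnorm g y v) /\ dom
  c y],
        ball v (r / 2)).
  split => /=; first by apply: filterI => //; apply: filterI => //;
    exact: near_dom.
  exact: nbhsx_ballx.
move=> [y w] /= [[Ay [Hy cy]] vw] w' w'w.
rewrite /= -(to_chartK cy w').
apply: (AB (y, to_chart c y w')); split=> //=; apply: rB.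
have : `|to_chart c y w' - w| < r / 2.
  have := le_lt_trans (Hy _) w'w.
  rewrite -scaleN1r addrC (to_chart_linear c y) scaleN1r (of_chartK cy) addrC.
  by rewrite ltr_pM2l.
move: vw; rewrite -!ball_normE /ball_ /= => H1 H2.
have -> : v - to_chart c y w' = (v - w) - (to_chart c y w' - w)
  by rewrite opprB addrA subrK.
by rewrite (le_lt_trans (ler_normB _ _))// [r]splitr ltrD.
Qed.

End Compactness.

Section Uniform.
Context {R : realType} {n : nat} {M : closed_manifold R n}.
Local Notation V := 'rV[R]_n.
Variable g : M -> V -> V -> R.
Hypothesis g_ip : inner_products g.
Hypothesis g_cont : metric_class 0 g.

Lemma tnorm_tmap_cvg (f : M -> M) x v : C1_map f ->
  (fun z : M * V => tnorm g (f z.1) (tmap f z.1 z.2)) @ tnbhs x v -->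
  tnorm g (f x) (tmap f x v).
Proof.
move=> Cf; exact: (cvg_comp _ _ (tmap_cvg (v := v) Cf)
  (tnorm_cvg g_ip g_cont (x := f x) (v := tmap f x v))).
Qed.

Lemma ratio_bound (q : M -> V -> R) :
  (forall x a v, q x (a *: v) = `|a| * q x v) ->
  (forall x v, q z.1 z.2 @[z --> tnbhs x v] --> q x v) ->
  exists2 L, 0 < L & forall x v, q x v <= L * tnorm g x v.
Proof.
move=> qZ qc.
have H : \forall d \near 0^'+, forall x v, v != 0 -> d * q x v <= tnorm g x v.
  apply: (@near_everywhere R n M R (0^'+) _
    (fun d x v => d * q x v <= tnorm g x v)).
    by move=> d x a v a0 H; rewrite qZ tnorm_scale// mulrCA ler_wpM2l.
  move=> x v v0.
  exact: (pos_near_scale (qc x v) (tnorm_cvg g_ip g_cont (x := x) (v := v))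
    (tnorm_gt0 g_ip x v0)).
have [d [Hd d0]] := @filter_ex _ (0^'+) _ _ (filterI H (nbhs_right_gt (0 : R))).
exists d^-1; first by rewrite invr_gt0.
move=> x v; have [->|v0] := eqVneq v 0.
  rewrite -(scale0r 0) qZ tnorm_scale// normr0 !mul0r mulr0//.
by rewrite -(ler_pM2l d0) mulrA mulfV ?gt_eqF// mul1r; exact: Hd.
Qed.

Lemma tmap_bound (f : M -> M) : C1_map f ->
  exists2 L, 0 < L & forall x v, tnorm g (f x) (tmap f x v) <= L * tnorm g x v.
Proof.
move=> Cf; apply: (ratio_bound (q := fun x v => tnorm g (f x) (tmap f x v))).
  by move=> x a v; rewrite (linear_scale (tmap_linear f x)) tnorm_scale.
by move=> x v; exact: tnorm_tmap_cvg.
Qed.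

(** The claim is homogeneous in [v], so it is enough to find [e] locally. Near a vector of the cone,
    [tnbhs_ball] gives an absolute radius [r], made relative by the bound [B] on the image. Near a
    vector outside the cone, closedness makes the claim vacuous. *)
Lemma uniform_cone (f : M -> M) (C : M -> V -> Prop) : C1_map f ->
  (forall x, C x 0) -> (forall x a v, C x v -> C x (a *: v)) ->
  (forall x v, ~ C x v -> tnbhs x v [set z : M * V | ~ C z.1 z.2]) ->
  (forall x v, C x v -> v != 0 ->
    tnbhs (f x) (tmap f x v) [set z : M * V | C z.1 z.2]) ->
  exists e, [/\ 0 < e, e < 1 & forall x v w, C x v ->
    tnorm g (f x) (w - tmap f x v) <= e * tnorm g (f x) (tmap f x v) ->
      C (f x) w].
Proof.
move=> Cf C0 CZ Ccl Cop.
have H : \forall e \near 0^'+, forall x v, v != 0 -> C x v -> forall w,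
    tnorm g (f x) (w - tmap f x v) <= e * tnorm g (f x) (tmap f x v) ->
      C (f x) w.
  apply: (@near_everywhere R n M R (0^'+) _ (fun e x v => C x v -> forall w,
    tnorm g (f x) (w - tmap f x v) <= e * tnorm g (f x) (tmap f x v) ->
      C (f x) w)).
    move=> e x a v a0 H /(CZ _ a^-1); rewrite scalerA mulVf// scale1r => Cv w.
    rewrite (linear_scale (tmap_linear f x)) => Hw.
    rewrite -[w]scale1r -(mulfV a0) -scalerA; apply: CZ; apply: H => //.
    have -> : a^-1 *: w - tmap f x v = a^-1 *: (w - a *: tmap f x v).
      by rewrite scalerBr scalerA mulVf// scale1r.
    rewrite tnorm_scale// normfV ler_pdivrMl ?normr_gt0// (le_trans Hw)//.
    by rewrite tnorm_scale// mulrCA.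
  move=> x v v0; have [Cv|nCv] := pselect (C x v); last first.
    exists ([set z : M * V | ~ C z.1 z.2], setT); first by split;
      [exact: Ccl | exact: filterT].
    by move=> [[y w] e] /= [nC _].
  have [r r0 Hr] := tnbhs_ball g_ip g_cont (Cop _ _ Cv v0).
  pose B := tnorm g (f x) (tmap f x v) + 1.
  have B0 : 0 < B by rewrite ltr_wpDl ?tnorm_ge0.
  have nB : \forall z \near tnbhs x v, tnorm g (f z.1) (tmap f z.1 z.2) < B.
    by have := cvgr_lt _ (@tnorm_tmap_cvg f x v Cf); apply; rewrite ltrDl.
  have nr : \forall z \near tnbhs x v, forall w,
      tnorm g (f z.1) (w - tmap f z.1 z.2) < r -> C (f z.1) w.
    exact: (tmap_cvg (v := v) Cf Hr).
  exists ([set z : M * V | tnorm g (f z.1) (tmap f z.1 z.2) < B /\ forall w,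
      tnorm g (f z.1) (w - tmap f z.1 z.2) < r -> C (f z.1) w],
        [set e | 0 < e /\ e < r / B]).
    split; first exact: filterI.
    apply: filterI; first exact: nbhs_right_gt.
    by apply: nbhs_right_lt; rewrite divr_gt0.
  move=> [[y w] e] /= [[yB yr] [e0 er]] Cw w' Hw'; apply: yr.
  apply: (le_lt_trans Hw'); apply: (@le_lt_trans _ _ (e * B)).
    by rewrite ler_wpM2l// ltW.
  by rewrite -ltr_pdivlMr.
have [e [He [e0 e1]]] := @filter_ex _ (0^'+) _ _
  (filterI H (filterI (nbhs_right_gt (0 : R)) (nbhs_right_lt (@ltr01 R)))).
exists e; split => // x v w Cv Hw.
have [v0|v0] := eqVneq v 0; last exact: He Cv w Hw.
move: Hw; rewrite v0 (linear_zero (tmap_linear f x)) subr0.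
have -> : tnorm g (f x) 0 = 0
  by rewrite -(scale0r 0) tnorm_scale// normr0 mul0r.
rewrite mulr0; have [-> //|w0] := eqVneq w 0.
by rewrite leNgt tnorm_gt0.
Qed.

Variables (q : M -> V -> R) (delta : R).
Hypothesis qZ : forall x a v, q x (a *: v) = `|a| * q x v.
Hypothesis q_cvg : forall x v, q z.1 z.2 @[z --> tnbhs x v] --> q x v.

(** The fibrewise operator norm of [q] relative to [tnorm g], bounded below by [delta] so that it
    may be inverted even where [q] vanishes. *)
Definition ratio_sup (x : M) : R :=
  sup [set t | t = delta \/ exists2 v, v != 0 & t = q x v / tnorm g x v].

Let ratio_has_sup x :
  has_sup [set t | t = delta \/ exists2 v, v != 0 & t = q x v / tnorm g x v].
Proof.
split; first by exists delta; left.
have [L L0 HL] := ratio_bound qZ q_cvg.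
exists (Num.max delta L) => t /= [->|[v v0 ->]]; rewrite le_max ?lexx//.
by apply/orP; right; rewrite ler_pdivrMr ?tnorm_gt0.
Qed.

Lemma ratio_sup_ge_delta x : delta <= ratio_sup x.
Proof. by apply: ub_le_sup; [exact: (ratio_has_sup x).2 | left]. Qed.

Lemma ratio_sup_ge x v : q x v <= ratio_sup x * tnorm g x v.
Proof.
have [->|v0] := eqVneq v 0.
  by rewrite -(scale0r 0) qZ tnorm_scale// normr0 !mul0r mulr0.
rewrite -ler_pdivrMr ?tnorm_gt0//.
by apply: ub_le_sup; [exact: (ratio_has_sup x).2 | right; exists v].
Qed.

Lemma ratio_sup_le x t : delta <= t ->
  (forall v, v != 0 -> q x v <= t * tnorm g x v) -> ratio_sup x <= t.
Proof.
move=> dt H; apply: ge_sup; first exact: (ratio_has_sup x).1.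
by move=> r /= [->//|[v v0 ->]]; rewrite ler_pdivrMr ?tnorm_gt0// H.
Qed.

(** From below, a nearly optimal vector at [x] extends with constant coordinates and remains nearly
    optimal. From above, the strict bound at [x] holds for all vectors over nearby points, by
    compactness of the sphere. *)
Lemma ratio_sup_continuous : continuous ratio_sup.
Proof.
move=> x; apply/cvgrPdist_lt => e e0.
have lower : \forall y \near x, ratio_sup x - e < ratio_sup y.
  have [t /= Ht lt] := sup_adherent e0 (ratio_has_sup x);
    rewrite -/(ratio_sup x) in lt.
  case: Ht lt => [-> lt|[v v0 ->] lt].
    by apply: nearW => y; exact: lt_le_trans lt (ratio_sup_ge_delta y).
  rewrite ltr_pdivlMr ?tnorm_gt0// in lt.
  pose c := chart_at x; have cx : dom c x := dom_chart_at x.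
  pose s := ratio_sup x - e.
  have cs : tcontinuous (fun y => of_chart c y v) x :=
    tcontinuous_of_chart (v := v) cx.
  have cq : (fun y => s * tnorm g y (of_chart c y v) - q y (of_chart c y v)) @ x
    --> s * tnorm g x v - q x v.
    have nc := tnorm_cvg g_ip g_cont (x := x) (v := of_chart c x v).
    have := cvg_comp _ _ cs nc;
      have := cvg_comp _ _ cs (@q_cvg x (of_chart c x v)).
    rewrite of_chart_at => H1 H2.
    have H3 : (fun y => s * tnorm g y (of_chart c y v)) @ x --> s * tnorm g x v.
      by apply: cvgM; [exact: cvg_cst | exact: H2].
    exact: (cvgB H3 H1).
  have : \forall y \near x,
    s * tnorm g y (of_chart c y v) - q y (of_chart c y v) < 0.
    by have := cvgr_lt _ cq; apply; rewrite subr_lt0.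
  apply: filterS => y; rewrite subr_lt0 => H; rewrite ltNge; apply/negP => ys.
  have := lt_le_trans H (ratio_sup_ge y (of_chart c y v)).
  by rewrite ltNge ler_wpM2r ?tnorm_ge0.
have upper : \forall y \near x, ratio_sup y < ratio_sup x + e.
  pose t := ratio_sup x + e / 2.
  have e20 : 0 < e / 2 by rewrite divr_gt0.
  have xt : ratio_sup x < t by rewrite ltrDl.
  have : \forall y \near x, forall v, v != 0 -> q y v < t * tnorm g y v.
    apply: near_vectors => [y a v a0|v v0].
      by rewrite qZ tnorm_scale// mulrCA ltr_pM2l// normr_gt0.
    have cq : (fun z : M * V => t * tnorm g z.1 z.2 - q z.1 z.2) @ tnbhs x v -->
      t * tnorm g x v - q x v.
      apply: cvgB (@q_cvg x v).
      by apply: cvgM; [exact: cvg_cst | exact: tnorm_cvg].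
    have : \forall z \near tnbhs x v, 0 < t * tnorm g z.1 z.2 - q z.1 z.2.
      have := cvgr_gt _ cq; apply;
        rewrite subr_gt0 (le_lt_trans (ratio_sup_ge x v))//.
      by rewrite ltr_pM2r// tnorm_gt0.
    by apply: filterS => z; rewrite subr_gt0.
  apply: filterS => y H; apply: (@le_lt_trans _ _ t).
    apply: ratio_sup_le => [|v v0]; last exact/ltW/H.
    exact: le_trans (ratio_sup_ge_delta x) (ltW xt).
  by rewrite ltrD2l ltr_pdivrMr// mulr_natr mulr2n ltrDl.
by apply: filterS2 lower upper => y l u; rewrite distrC ltr_distl l u.
Qed.

End Uniform.

(** * Continuity of splittings *)

Section Projective.
Context {R : realType} {n : nat}.
Local Notation V := 'rV[R]_n.

(* Every (a, 1) is a positive multiple of a point of this compact set. *)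
Definition projective : set (V * R) :=
  ([set v | `|v| = 1] `*` `[0, 1]%classic) `|`
    ([set v | `|v| <= 1] `*` [set 1]).

Lemma projective_compact : compact projective.
Proof.
apply: compactU; apply: compact_setX; first exact: sphere_compact.
- exact: segment_compact.
- apply: bounded_closed_compact.
    by exists 1; split => // r r1 w /= w1; exact: le_trans w1 (ltW r1).
  apply: (@preimage_closed V R (fun w => `|w|) [set r | r <= 1]);
    last exact: closed_le.
  by move=> w _; exact: norm_continuous.
- exact: compact_set1.
Qed.

Lemma projective_neq0 : ~ projective (0, 0).
Proof.
case=> -[/=]; first by rewrite normr0 => /eqP; rewrite eq_sym oner_eq0.
by move=> _ /eqP; rewrite eq_sym oner_eq0.
Qed.

Lemma projective_rescale (a : V) : exists2 m,
  0 < m & projective (m^-1 *: a, m^-1).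
Proof.
have m0 : 0 < Num.max `|a| 1 by rewrite lt_max ltr01 orbT.
exists (Num.max `|a| 1) => //; set m := Num.max _ _ in m0 *.
have am : `|m^-1 *: a| = `|a| / m by rewrite normrZ normfV (gtr0_norm m0) mulrC.
have [a1|a1] := leP 1 `|a|.
  left; split; rewrite /= ?am.
    by rewrite /m max_l// mulfV// gt_eqF// (lt_le_trans _ a1).
  by rewrite in_itv /= invr_ge0 (ltW m0) invf_le1// /m le_max lexx orbT.
right; split; rewrite /= ?am; first by rewrite ler_pdivrMr// mul1r le_max lexx.
by rewrite /m max_r ?invr1// ltW.
Qed.

End Projective.

Section Splitting.
Context {R : realType} {n : nat} {M : closed_manifold R n}.
Local Notation V := 'rV[R]_n.

(** The total space is closed in TM. Semicontinuity of this kind on both summands will force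
    continuity of each. *)
Definition closed_family (E : M -> {vspace V}) : Prop := forall x v,
  v \notin E x -> tnbhs x v [set z : M * V | z.2 \notin E z.1].

Variables (E1 E2 : M -> {vspace V}).
Hypotheses (E1_closed : closed_family E1) (E2_closed : closed_family E2).
Hypothesis E12 : forall x v, v \in E1 x -> v \in E2 x -> v = 0.
Variable p : M -> V -> V.
Hypothesis p1 : forall x v, p x v \in E1 x.
Hypothesis p2 : forall x v, v - p x v \in E2 x.

Lemma proj_unique x v w : w \in E1 x -> v - w \in E2 x -> w = p x v.
Proof.
move=> w1 w2; apply/subr0_eq/(E12 (x := x)); first by rewrite rpredB.
have -> : w - p x v = (v - p x v) - (v - w)
  by rewrite opprB [RHS]addrC addrA subrK.
by rewrite rpredB.
Qed.

Lemma proj_id x v : v \in E1 x -> p x v = v.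
Proof. by move=> v1; rewrite -(proj_unique v1)// subrr rpred0. Qed.

Lemma proj_linear x : linear (p x).
Proof.
move=> a v w; rewrite -(@proj_unique x (a *: v + w) (a *: p x v + p x w))//.
  by rewrite rpredD// rpredZ.
by rewrite opprD addrACA -scalerBr rpredD// rpredZ.
Qed.

(* In coordinates, a decomposition t w = a + b is rescaled so that (a, t) ranges
   over a compact set; t = 0 is excluded in the limit because E1 and E2 meet
   only in 0, which bounds the projections near x. *)
Lemma proj_cvg x v : (z.1, p z.1 z.2) @[z --> tnbhs x v] --> tnbhs x (p x v).
Proof.
move=> P NP; pose c := chart_at x; have cx : dom c x := dom_chart_at x.
pose Q (z : M * V) (at_ : V * R) := of_chart c z.1 at_.1 \in E1 z.1 ->
  of_chart c z.1 (at_.2 *: z.2 - at_.1) \in E2 z.1 ->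
  at_.2 != 0 /\ P (z.1, of_chart c z.1 (at_.2^-1 *: at_.1)).
have NQ : \forall z \near (x, v), projective `<=` Q z.
  apply: ((iffLR (compact_near_coveringP _) projective_compact) (M * V)%type
    (nbhs (x, v)) Q _) => -[a t] Kat.
  have pullback (h : (V * R) * (M * V) -> V) (U : M * V -> Prop) w :
      h @ ((a, t), (x, v)) --> w -> tnbhs x w U ->
      \forall y \near ((a, t), (x, v)), U (y.2.1, of_chart c y.2.1 (h y)).
    move=> hw Uw; have cv : (fun y : (V * R) * (M * V) => (y.2.1, h y)) @
      ((a, t), (x, v)) --> (x, w).
      apply: cvg_to_pair => //.
      exact: (cvg_comp snd fst (@snd_cvg _ _ (a, t) (x, v)) (@fst_cvg _ _ x v)).
    exact: (cv _ Uw).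
  have ca : (fun y : (V * R) * (M * V) => y.1.1) @ ((a, t), (x, v)) --> a.
    exact: (cvg_comp fst fst (@fst_cvg _ _ (a, t) (x, v)) (@fst_cvg _ _ a t)).
  have ct : (fun y : (V * R) * (M * V) => y.1.2) @ ((a, t), (x, v)) --> t.
    exact: (cvg_comp fst snd (@fst_cvg _ _ (a, t) (x, v)) (@snd_cvg _ _ a t)).
  have cv : (fun y : (V * R) * (M * V) => y.2.2) @ ((a, t), (x, v)) --> v.
    exact: (cvg_comp snd snd (@snd_cvg _ _ (a, t) (x, v)) (@snd_cvg _ _ x v)).
  (* If one membership fails at the limit point, it fails nearby and [Q] is vacuous there. Otherwise
     [t] is nonzero and [t^-1 *: a] is the projection, so the conclusion of [Q] is an open
     condition. *)
  have [a1|a1] := boolP (a \in E1 x); last first.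
    have := pullback _ _ _ ca (E1_closed a1).
    by apply: filterS => y /= /negP H1 H2.
  have cd : (fun y : (V * R) * (M * V) => y.1.2 *: y.2.2 - y.1.1) @
    ((a, t), (x, v)) --> t *: v - a.
    by apply: cvgB ca; exact: cvgZ.
  have [b2|b2] := boolP (t *: v - a \in E2 x); last first.
    have := pullback _ _ _ cd (E2_closed b2).
    by apply: filterS => y /= /negP H2 _ H1.
  have t0 : t != 0.
    apply/eqP => t0; move: b2 Kat; rewrite t0 scale0r sub0r rpredN => b2.
    by rewrite (E12 a1 b2); exact: projective_neq0.
  have ap : t^-1 *: a = p x v.
    apply: proj_unique; first by rewrite rpredZ.
    have -> : v - t^-1 *: a = t^-1 *: (t *: v - a)
      by rewrite scalerBr scalerA mulVf// scale1r.
    by rewrite rpredZ.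
  have cq : (fun y : (V * R) * (M * V) => y.1.2^-1 *: y.1.1) @ ((a, t), (x, v))
    --> p x v.
    by rewrite -ap; apply: cvgZ => //; exact: cvgV.
  have nt : \forall y \near ((a, t), (x, v)), y.1.2 != 0.
    have nt0 : \forall r \near t, r != 0 by apply: open_nbhs_nbhs; split;
      [exact: open_neq | exact: t0].
    exact: (ct _ nt0).
  by have := pullback _ _ _ cq NP; apply: filterS2 nt => y yt HP _ _.
have : \forall z \near (x, v), dom c z.1.
  by apply: (@fst_cvg M V x v (dom c)); exact: near_dom.
rewrite /tnbhs -/c; apply: filterS2 NQ => -[y w] KQ cy /=.
pose a := to_chart c y (p y (of_chart c y w)).
have [m m0 Kam] := projective_rescale a.
have ofa : of_chart c y a = p y (of_chart c y w) by rewrite to_chartK.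
have [|||_] := KQ (m^-1 *: a, m^-1).
- exact: Kam.
- by rewrite /= (linear_scale (of_chart_linear c y)) ofa rpredZ.
- rewrite /= -scalerBr (linear_scale (of_chart_linear c y)) rpredZ//.
  by rewrite addrC -scaleN1r (of_chart_linear c y) scaleN1r ofa addrC.
by rewrite /= invrK scalerA mulfV ?gt_eqF// scale1r ofa.
Qed.

(** A nonzero vector at [x] lies outside [E1 x] or outside [E2 x], and both families are closed, so
    the exclusion persists nearby. This keeps the projection injective on [E1 x] transported by the
    chart. *)
Lemma near_transverse x :
  \forall y \near x, forall w, w \in E1 x ->
    of_chart (chart_at x) y w \in E2 y -> w = 0.
Proof.
pose c := chart_at x; have cx : dom c x := dom_chart_at x.
have : \forall y \near x, forall v, v != 0 -> to_chart c y v \in E1 x ->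
  v \notin E2 y.
  apply: (@near_vectors R n M
    (fun y v => to_chart c y v \in E1 x -> v \notin E2 y)).
    move=> y a v a0 H; rewrite (linear_scale (to_chart_linear c y)) => av.
    have {}av : to_chart c y v \in E1 x.
      by rewrite -[X in X \in _]scale1r -(mulVf a0) -scalerA rpredZ.
    apply: contra (H av) => av2.
    by rewrite -[v]scale1r -(mulVf a0) -scalerA rpredZ.
  move=> v v0; have [v1|v1] := boolP (v \in E1 x).
    have v2 : v \notin E2 x by apply: contra v0 => v2; rewrite (E12 v1 v2).
    by apply: filterS (E2_closed v2) => z /= ? _.
  have nv : \forall w \near v, w \notin E1 x := tnbhs_fibre (E1_closed v1).
  have vE : to_chart c x v = v by rewrite -{1}(of_chart_at x v) of_chartK.
  rewrite -vE in nv; have nz : tnbhs x v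
    [set z : M * V | to_chart c z.1 z.2 \notin E1 x] :=
    to_chart_cvg (v := v) cx nv.
  by apply: filterS nz => z /= /negP H1 H2.
apply: filterS2 (near_dom cx) => y cy H w w1 w2.
apply/eqP; apply: contraTT w2 => w0; apply: H; last by rewrite of_chartK.
by apply: contra_neq w0 => H;
  rewrite -(of_chartK cy w) H (linear_zero (to_chart_linear c y)).
Qed.

Hypothesis dimE1 : forall x y, \dim (E1 x) = \dim (E1 y).

(** The frame is obtained by extending a basis of [E1 x] with constant coordinates and projecting it
    to [E1 y]. [proj_cvg] makes it continuous; injectivity and equality of dimensions make it a
    basis. *)
Lemma splitting_subbundle : subbundle E1.
Proof.
move=> x; pose c := chart_at x; have cx : dom c x := dom_chart_at x.
exists (\dim (E1 x)), (fun k y =>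
  to_chart c y (p y (of_chart c y (tnth (vbasis (E1 x)) k)))).
apply: filterS2 (near_dom cx) (near_transverse x) => y cy inj; split.
  move=> k; apply/(tcontinuousP _ cy).
  exact: (cvg_comp _ _ (tcontinuous_of_chart (v := _) cy) (@proj_cvg y _)).
have Llin : linear (p y \o of_chart c y).
  by move=> a v w /=; rewrite (of_chart_linear c y) proj_linear.
pose L : {linear V -> V} :=
  HB.pack (p y \o of_chart c y) (GRing.isLinear.Build R V V *:%R _ Llin).
have LE w : linfun L w = p y (of_chart c y w) by rewrite lfunE.
move: (linfun L) LE => {Llin L} L LE.
have -> : [seq of_chart c y
  (to_chart c y (p y (of_chart c y (tnth (vbasis (E1 x)) k)))) | k <- enum
  'I_(\dim (E1 x))] = map L (vbasis (E1 x)).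
  rewrite -[in RHS]map_tnth_enum -[RHS]map_comp; apply: eq_map => k /=.
  by rewrite LE to_chartK.
have ker0 : (E1 x :&: lker L)%VS = 0%VS.
  apply/eqP; rewrite -subv0; apply/subvP => w /memv_capP[w1].
  rewrite memv_ker LE memv0 => /eqP pw; apply/eqP/inj => //.
  by have := p2 y (of_chart c y w); rewrite pw subr0.
suff -> : E1 y = (L @: E1 x)%VS by exact: limg_basis_of ker0 (vbasisP _).
apply/eqP; rewrite eq_sym eqEdim limg_dim_eq// (dimE1 x y) leqnn andbT.
by apply/subvP => w /memv_imgP[v _ ->]; rewrite LE p1.
Qed.

End Splitting.

(** * Adapted metrics *)

Lemma geometric_unbounded (R : realType) (a c : R) : 1 < a ->
  exists N, forall k, (N <= k)%N -> c <= a ^+ k.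
Proof.
move=> a1; have a0 : 0 < a by exact: lt_trans a1.
have [N HN] : exists N, c <= a ^+ N.
  apply: contrapT => /forallNP H.
  have [c0|c0] := leP c 0; first by case: (H 0%N); rewrite expr0 (le_trans c0).
  have a10 : 0 < a - 1 by rewrite subr_gt0.
  suff : (1 : R) <= 0 by rewrite ler10.
  apply: (@geometric_bound _ (a - 1) _ c) => // k; rewrite addrC subrK mulr1.
  by rewrite leNgt; apply/negP => /ltW; exact: H.
exists N => k Nk; apply: (le_trans HN); rewrite -(subnK Nk) exprD.
by rewrite ler_peMl ?exprn_ge0 ?(ltW a0)// exprn_ege1// ltW.
Qed.

Section Windows.
Variables (R : realType) (P : nat) (s a : nat -> R) (c : R).
Hypothesis s_gt0 : forall k, 0 < s k.
Hypotheses (a_gt0 : forall k, 0 < a k) (c_gt0 : 0 < c).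

Let u k := \prod_(j < P) s (k + j)%N.

Let uS k : u k.+1 * s k = u k * s (k + P)%N.
Proof.
have e1 : \prod_(j < P.+1) s (k + j)%N = u k * s (k + P)%N
  by rewrite big_ord_recr.
rewrite -e1 big_ord_recl addn0 mulrC; congr (_ * _).
by apply: eq_bigr => j _; rewrite /bump /= addnS.
Qed.

Let powE (x : R) : x ^+ P = \prod_(j < P) x.
Proof. by rewrite prodr_const card_ord. Qed.

(* The window products [u] satisfy [uS]; they replace the averaging over
   residues modulo P in Gourmelon's construction of adapted metrics. *)
Lemma window_lower k : (forall k, c * a k * s k <= s (k + P)%N) ->
  (forall k, s k <= s k.+1) ->
  c ^+ k * (\prod_(i < k) a i) * s 0%N ^+ P <= s (k + P)%N ^+ P.
Proof.
move=> sP s_incr.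
have smono i j : (i <= j)%N -> s i <= s j.
  by move=> /subnK <-; elim: (j - i)%N => // m IH; rewrite addSn (le_trans IH).
have u0 : s 0%N ^+ P <= u 0%N.
  rewrite powE; apply: ler_prod => j _.
  by rewrite ltW//= smono.
have uk : u k <= s (k + P)%N ^+ P.
  rewrite powE; apply: ler_prod => j _.
  by rewrite ltW//= smono// leq_add2l ltnW.
(* By [uS] the hypothesis on [s] reads [u k.+1 >= c * a k * u k], and the product telescopes. *)
apply: le_trans uk; elim: k => [|k IH]; first by rewrite big_ord0 expr0 !mul1r.
rewrite -(ler_pM2r (s_gt0 k)) uS; apply: le_trans (ler_wpM2l _ (sP k));
  last first.
  by apply: prodr_ge0 => j _; exact: ltW.
have -> : c ^+ k.+1 * (\prod_(i < k.+1) a i) * s 0%N ^+ P * s k =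
    c ^+ k * (\prod_(i < k) a i) * s 0%N ^+ P * (c * a k * s k).
  by rewrite big_ord_recr exprS /=; ring.
by rewrite ler_wpM2r// !mulr_ge0// ltW.
Qed.

(** Here [s] need not be monotone. Within a window its values are compared through [L ^+ P], which
    costs [(L ^+ P) ^+ P] at the first window and again at the last; this constant does not depend
    on [k]. *)
Lemma window_upper k (L : R) : 1 <= L ->
  (forall k, s (k + P)%N <= c * a k * s k) ->
  (forall k, s k.+1 <= L * s k) ->
  s (k + P)%N ^+ P <= (L ^+ P) ^+ P * (L ^+ P) ^+ P *
    (c ^+ k * (\prod_(i < k) a i) * s 0%N ^+ P).
Proof.
move=> L1 sP s_incr; have L0 : 0 <= L by exact: le_trans L1.
have smono i j : (i <= j)%N -> (j <= i + P)%N -> s j <= L ^+ P * s i.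
  move=> ij jiP; apply: (@le_trans _ _ (L ^+ (j - i) * s i)); last first.
    rewrite ler_wpM2r ?(ltW (s_gt0 _))// ler_weXn2l//.
    by rewrite leq_subLR.
  move: ij => /subnK {1}<-; elim: (j - i)%N => [|m IH]; first by rewrite mul1r.
  by rewrite addSn (le_trans (s_incr _))// exprS -mulrA ler_wpM2l.
have LP0 : 0 <= L ^+ P by rewrite exprn_ge0.
have u0 : u 0%N <= (L ^+ P) ^+ P * s 0%N ^+ P.
  rewrite -exprMn (powE (_ * _)); apply: ler_prod => j _.
  by apply/andP; split; [exact: ltW | apply: smono => //; rewrite !add0n ltnW].
have uk : s (k + P)%N ^+ P <= (L ^+ P) ^+ P * u k.
  rewrite (powE (s _)) (powE (L ^+ P)) -big_split /=. apply: ler_prod => j _.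
  apply/andP; split; first exact: ltW.
  apply: smono; first by rewrite leq_add2l ltnW.
  by rewrite -addnA leq_add2l leq_addl.
apply: (le_trans uk); rewrite -mulrA ler_wpM2l ?exprn_ge0//.
suff : u k <= c ^+ k * (\prod_(i < k) a i) * u 0%N.
  move=> H; apply: (le_trans H).
  rewrite [leRHS]mulrCA; rewrite ler_wpM2l//.
  by rewrite mulr_ge0 ?exprn_ge0 ?(ltW c_gt0)// prodr_ge0// => i _; exact: ltW.
elim: k {uk} => [|k IH]; first by rewrite big_ord0 expr0 !mul1r.
rewrite -(ler_pM2r (s_gt0 k)) uS; apply: le_trans (ler_wpM2l _ (sP k)) _.
  by apply: prodr_ge0 => j _; exact: ltW.
have -> : c ^+ k.+1 * (\prod_(i < k.+1) a i) * u 0%N * s k =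
    c ^+ k * (\prod_(i < k) a i) * u 0%N * (c * a k * s k).
  by rewrite big_ord_recr exprS /=; ring.
by rewrite ler_wpM2r// !mulr_ge0// ltW.
Qed.

End Windows.

Section Adapted.
Context {R : realType} {n : nat} {M : closed_manifold R n}.
Local Notation V := 'rV[R]_n.
Variable g : M -> V -> V -> R.
Hypothesis g_ip : inner_products g.
Hypothesis g_cont : metric_class 0 g.
Local Notation N := (tnorm g).

(** [metric_class] concerns pairs of vectors with constant coordinates; continuity of the quadratic
    form on TM suffices, by the polarization identity. *)
Lemma polarization_metric (q : M -> V -> V -> R) : inner_products q ->
  (forall x v, q z.1 z.2 z.2 @[z --> tnbhs x v] --> q x v v) ->
    metric_class 0 q.
Proof.
move=> q_ip qc a v w _ [x ax <-] /=.
have pol y u u' : q y u u' =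
  (q y (u + u') (u + u') - q y (u - u') (u - u')) / 4.
  rewrite !(inner_addl q_ip, inner_addr q_ip, inner_oppl q_ip, inner_oppr q_ip).
  by rewrite (inner_sym q_ip y u' u); field.
pose e r y := of_chart a y (r *: w + v).
have ce r : (fun y => q y (e r y) (e r y)) @ x --> q x (e r x) (e r x).
  have ct : tcontinuous (e r) x := tcontinuous_of_chart (v := _) ax.
  exact: (cvg_comp _ _ ct (qc x (e r x))).
have cq : (fun y => q y (of_chart a y v) (of_chart a y w)) @ x -->
  q x (of_chart a x v) (of_chart a x w).
  have E y : q y (of_chart a y v) (of_chart a y w) =
      (q y (e 1 y) (e 1 y) - q y (e (-1) y) (e (-1) y)) / 4.
    rewrite pol /e !(of_chart_linear a y) scale1r scaleN1r.
    by rewrite (addrC (of_chart a y w)) (addrC (- _)).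
  rewrite E (funext E).
  by apply: cvgM; [apply: cvgB; exact: ce | exact: cvg_cst].
have ci : icoord a @ Defs.coord a x --> x.
  have := icoord_continuous ax.
  by rewrite /prop_for /continuous_at coordK.
have := cvg_comp _ _ ci cq.
by rewrite /prop_for /continuous_at /= coordK.
Qed.

Variables f h : M -> M.
Hypotheses (Cf : C1_map f) (Ch : C1_map h) (fK : cancel f h) (hK : cancel h f).
Local Notation fpush := (push f (tmap f)).
Local Notation hpush := (push h (tmap h)).

Lemma push_cvg (f' : M -> M) (C' : C1_map f') k x v :
  (iter k f' z.1, push f' (tmap f') k z.1 z.2) @[z --> tnbhs x v] -->
  tnbhs (iter k f' x) (push f' (tmap f') k x v).
Proof.
elim: k => [|k IH] /=.
  by apply: cvg_trans (@cvg_id _ (tnbhs x v)); apply: near_eq_cvg;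
    apply: nearW => -[].
exact: (cvg_comp _ _ IH (tmap_cvg (v := _) C')).
Qed.

Lemma tnorm_push_bound k : exists2 L, 0 < L &
  forall x v, N (iter k f x) (fpush k x v) <= L * N x v.
Proof.
apply: (ratio_bound g_ip g_cont (q := fun x v => N (iter k f x) (fpush k x v))).
  by move=> x a v; rewrite (push_scalev f (tmap_linear f)) tnorm_scale.
by move=> x v; exact: (cvg_comp _ _ (push_cvg Cf (k := k) (x := x) (v := v))
    (tnorm_cvg g_ip g_cont (x := iter k f x) (v := fpush k x v))).
Qed.

Lemma iter_continuous k : continuous (iter k f).
Proof.
elim: k => [|k IH] x /=; first exact: cvg_id.
exact: (cvg_comp _ _ (IH x) (Cf.1 _)).
Qed.

Variables E1 E2 : M -> {vspace V}.
Hypothesis E1_inv : forall x v, v \in E1 x -> tmap f x v \in E1 (f x).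
Hypothesis E1_back : forall x v, v \in E1 x -> tmap h x v \in E1 (h x).
Hypothesis E2_inv : forall x v, v \in E2 x -> tmap f x v \in E2 (f x).
Variable p : M -> V -> V.
Hypothesis p1 : forall x v, p x v \in E1 x.
Hypothesis p_id : forall x v, v \in E1 x -> p x v = v.
Hypothesis p_lin : forall x, linear (p x).
Hypothesis p_cvg : forall x v,
  (z.1, p z.1 z.2) @[z --> tnbhs x v] --> tnbhs x (p x v).
Variables kappa lambda : R.
Hypotheses (kappa_gt0 : 0 < kappa) (lambda_gt1 : 1 < lambda).
Hypothesis domination : forall x v w k, v \in E1 x -> w \in E2 x ->
  kappa * (1 + kappa) ^+ k * (N (iter k f x) (fpush k x w) * N x v) <=
  (1 + kappa) * (N (iter k f x) (fpush k x v) * N x w).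
Hypothesis expansion : forall x v, v \in E1 x ->
  lambda * N x v <= N (f x) (tmap f x v).

Lemma push_E1 k x v : v \in E1 x -> fpush k x v \in E1 (iter k f x).
Proof. by move=> v1; elim: k => //= k; exact: E1_inv. Qed.

Lemma push_E2 k x v : v \in E2 x -> fpush k x v \in E2 (iter k f x).
Proof. by move=> v1; elim: k => //= k; exact: E2_inv. Qed.

Lemma hpush_E1 k x v : v \in E1 x -> hpush k x v \in E1 (iter k h x).
Proof. by move=> v1; elim: k => //= k; exact: E1_back. Qed.

Lemma push_expansion k x v : v \in E1 x ->
  lambda ^+ k * N x v <= N (iter k f x) (fpush k x v).
Proof.
move=> v1; elim: k => [|k IH] /=; first by rewrite mul1r.
apply: le_trans (expansion (push_E1 k v1)).
by rewrite exprS -mulrA ler_wpM2l// (le_trans ler01)// ltW.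
Qed.

(* [b] is the reciprocal of the norm of A^(-P) composed with the projection to
   E^u; the maximum with a constant built into [ratio_sup] keeps it finite when
   u = 0. *)
Lemma growth_rate : exists (P : nat) (b : M -> R) (Bmax : R),
  [/\ (0 < P)%N, continuous b, forall x, 2 <= b x <= Bmax,
      forall x v, v \in E1 x -> b x * N x v <= N (iter P f x) (fpush P x v) &
      forall x w, w \in E2 x ->
        N (iter P f x) (fpush P x w) <= 2^-1 * b x * N x w].
Proof.
have [K K0 HK] : exists2 K, 0 < K & forall x v, N x (p x v) <= K * N x v.
  apply: (ratio_bound g_ip g_cont (q := fun x v => N x (p x v))).
    by move=> x a v; rewrite (linear_scale (p_lin x)) tnorm_scale.
  by move=> x v; exact: (cvg_comp _ _ (@p_cvg x v)
    (tnorm_cvg g_ip g_cont (x := x) (v := p x v))).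
have k1 : 1 < 1 + kappa by rewrite ltrDl.
pose D := (1 + kappa) / kappa.
have D0 : 0 < D by rewrite divr_gt0// (lt_trans _ k1).
(* [D] is the constant lost in [domination] and [K] the norm of the projection to [E1]. The factors
   2 in [P1] and [P2] give the factor [2^-1] on [E2] and the bound [2 <= b x] respectively. *)
have [P1 HP1] := geometric_unbounded (2 * (D * K)) k1.
have [P2 HP2] := geometric_unbounded (2 * K) lambda_gt1.
pose P := maxn 1 (maxn P1 P2).
have P0 : (0 < P)%N by rewrite leq_max.
have {}HP1 : 2 * (D * K) <= (1 + kappa) ^+ P by apply: HP1;
  rewrite /P !leq_max leqnn orbT.
have {}HP2 : 2 * K <= lambda ^+ P by apply: HP2;
  rewrite /P !leq_max leqnn !orbT.
have [L L0 HL] := tnorm_push_bound P.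
(* The floor of [ratio_sup] must respect both upper bounds required of [r]: [2^-1], and
   [N x w / (2 * N y Aw)], which is at least [(2 * L)^-1]. *)
pose d := Num.min (2^-1) (2 * L)^-1.
have d0 : 0 < d by rewrite lt_min !invr_gt0 mulr_gt0// ltr0n.
have d2 : d <= 2^-1 by rewrite ge_min lexx.
have dL : d <= (2 * L)^-1 by rewrite ge_min lexx orbT.
(* Composing with the projection makes the supremum range over all vectors rather than over the
   moving subspace [E1 y], so [ratio_sup_continuous] applies. *)
pose q y v := N (iter P h y) (hpush P y (p y v)).
have qZ x a v : q x (a *: v) = `|a| * q x v.
  by rewrite /q (linear_scale (p_lin x)) (push_scalev h (tmap_linear h))
    tnorm_scale.
have qc x v : q z.1 z.2 @[z --> tnbhs x v] --> q x v.
  have c1 := cvg_comp _ _ (@p_cvg x v) (push_cvg Ch (k := P) (v := p x v)).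
  exact: (cvg_comp _ _ c1
    (tnorm_cvg g_ip g_cont (x := iter P h x) (v := hpush P x (p x v)))).
pose r := ratio_sup g q d.
have r_ge : forall y, d <= r y := ratio_sup_ge_delta g_ip g_cont d qZ qc.
have r0 y : 0 < r y by exact: lt_le_trans (r_ge y).
have back y v : fpush P (iter P h y) (hpush P y v) = v.
  by apply: push_cancel => // x u; exact: tmapK.
have q_half y v : q y v <= 2^-1 * N y v.
  have := push_expansion P (hpush_E1 P (p1 y v)).
  rewrite back (iter_cancel hK) => H.
  have : lambda ^+ P * q y v <= K * N y v := le_trans H (HK y v).
  have q0 : 0 <= q y v by exact: tnorm_ge0.
  move=> H2; have := le_trans (ler_wpM2r q0 HP2) H2.
  rewrite (mulrC 2) -mulrA ler_pM2l// => H3.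
  by rewrite -(ler_pM2l (_ : 0 < 2 :> R))// mulrA mulfV// mul1r.
have r2 y : r y <= 2^-1.
  by apply: (ratio_sup_le g_ip g_cont qZ qc) => // v _; exact: q_half.
exists P, (fun x => (r (iter P f x))^-1), d^-1; split => //.
- move=> x; apply: cvgV; first by rewrite gt_eqF.
  have rc : continuous r := ratio_sup_continuous g_ip g_cont qZ qc.
  exact: (@continuous_comp M M R (iter P f) r x (@iter_continuous P x) (rc _)).
- move=> x; apply/andP; split; last by rewrite lef_pV2 ?posrE.
  by rewrite -[leLHS]invrK lef_pV2 ?posrE ?invr_gt0.
- move=> x v v1; rewrite mulrC ler_pdivrMr//.
  have qE : q (iter P f x) (fpush P x v) = N x v.
    rewrite /q p_id ?(iter_cancel fK); last exact: push_E1.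
    by congr (N x _); apply: push_cancel => // y u; exact: tmapK.
  by rewrite -qE mulrC; exact: (ratio_sup_ge g_ip g_cont d qZ qc).
move=> x w w2; have [->|w0] := eqVneq w 0.
  by rewrite (push_zero f (tmap_linear f)) /tnorm !inner_zero// sqrtr0 mulr0.
set y := iter P f x; set Aw := fpush P x w.
have Nw : 0 < N x w by exact: tnorm_gt0.
have Aw0 : 0 < N y Aw.
  apply: tnorm_gt0 => //; apply: contra_neq w0 => Aw0.
  have <- : hpush P y Aw = w by apply: push_cancel => // z u; exact: tmapK.
  by rewrite Aw0 (push_zero h (tmap_linear h)).
(* The goal solved for [r y], which is a supremum and can be bounded ratio by ratio; each ratio is
   controlled by domination of [w] by the pullback of [p y v]. *)
suff : r y <= N x w / (2 * N y Aw).
  rewrite ler_pdivlMr ?mulr_gt0// => H.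
  rewrite [leLHS](_ : _ = 2^-1 * (r y)^-1 * (r y * (2 * N y Aw))); last first.
    by field; rewrite gt_eqF.
  by rewrite ler_pM2l// mulr_gt0 ?invr_gt0.
apply: (ratio_sup_le g_ip g_cont qZ qc).
  apply: (le_trans dL); rewrite ler_pdivlMr ?mulr_gt0// ler_pdivrMl ?mulr_gt0//.
  by rewrite -mulrA ler_pM2l//; exact: HL.
move=> v _.
rewrite mulrAC ler_pdivlMr ?mulr_gt0//.
have Hv := hpush_E1 P (p1 y v).
have xE : iter P h y = x by rewrite /y (iter_cancel fK).
rewrite xE in Hv.
have := domination P Hv w2; rewrite -/y -/Aw.
have -> : fpush P x (hpush P y (p y v)) = p y v by rewrite -{1}xE back.
have -> : N x (hpush P y (p y v)) = q y v by rewrite /q xE.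
move=> H.
have H2 : kappa * (1 + kappa) ^+ P * (N y Aw * q y v) <=
  (1 + kappa) * (K * N y v * N x w).
  by apply: (le_trans H); rewrite ler_pM2l ?(lt_trans _ k1)// ler_pM2r.
have q0 : 0 <= q y v by exact: tnorm_ge0.
have H3 : kappa * (2 * (D * K)) * (N y Aw * q y v) <=
  (1 + kappa) * (K * N y v * N x w).
  apply: le_trans H2; rewrite ler_wpM2r ?mulr_ge0 ?(ltW Aw0)//.
  by rewrite ler_pM2l.
have kD : kappa * D = 1 + kappa by rewrite /D mulrC divfK// gt_eqF.
have E3 : kappa * (2 * (D * K)) * (N y Aw * q y v) =
  (1 + kappa) * K * (q y v * (2 * N y Aw)).
  by rewrite -kD; ring.
rewrite E3 [leRHS](_ : _ = (1 + kappa) * K * (N x w * N y v)) in H3;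
  last by ring.
by rewrite ler_pM2l ?mulr_gt0 ?(lt_trans _ k1) in H3.
Qed.

Lemma tnorm0 x : N x 0 = 0.
Proof. by rewrite /tnorm inner_zero// sqrtr0. Qed.

Lemma push_neq0 k x v : v != 0 -> fpush k x v != 0.
Proof.
apply: contra_neq => kv0.
have <- : hpush k (iter k f x) (fpush k x v) = v.
  by apply: push_cancel => // y u; exact: tmapK.
by rewrite kv0 (push_zero h (tmap_linear h)).
Qed.

(** The [P]-step rates on the two bundles are separated by a factor 2, so a [P]-th root of a
    function between them is a candidate weight. Its products along orbits match the growth up to
    boundary terms, which a long time [T] overcomes. *)
Lemma adapted_weight : exists (T : nat) (w_ : M -> R),
  [/\ (0 < T)%N, continuous w_, forall x, 1 < w_ x,
      forall x v, v \in E1 x ->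
        (\prod_(i < T) w_ (iter i f x)) * N x v <=
          N (iter T f x) (fpush T x v) &
      forall x v, v \in E2 x -> v != 0 ->
        N (iter T f x) (fpush T x v) < (\prod_(i < T) w_ (iter i f x)) * N x v].
Proof.
have [P [b [Bmax [P0 bc bB b1 b2]]]] := growth_rate.
have [L0 L00 HL0] := tmap_bound g_ip g_cont Cf.
pose L := Num.max 1 L0.
have L1 : 1 <= L by rewrite le_max lexx.
have HL x v : N (f x) (tmap f x v) <= L * N x v.
  apply: (le_trans (HL0 x v)); rewrite ler_wpM2r ?tnorm_ge0//.
  by rewrite le_max lexx orbT.
(* The rates are at least [b = 3 / 2 * a] on [E1] and at most [2^-1 * b = 3 / 4 * a] on [E2];
   moreover [b >= 2] gives [a >= 4 / 3 > 1]. *)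
pose a x := 2 / 3 * b x.
have a43 x : 4 / 3 <= a x by have /andP[+ _] := bB x; rewrite /a; lra.
have a0 x : 0 < a x by apply: lt_le_trans (a43 x); rewrite divr_gt0.
have aB x : a x <= Bmax by have /andP[] := bB x; rewrite /a; lra.
pose w_ x := expR (ln (a x) / P%:R).
have wP x : w_ x ^+ P = a x.
  rewrite /w_ -expRM_natr divfK ?pnatr_eq0 -?lt0n// lnK//.
  by rewrite posrE.
have w0 x : 0 < w_ x by exact: expR_gt0.
have c32 : (1 : R) < 3 / 2 by lra.
have c43 : (1 : R) < 4 / 3 by lra.
pose L2 := (L ^+ P) ^+ P * (L ^+ P) ^+ P.
have L20 : 0 < L2 by rewrite !(mulr_gt0, exprn_gt0)// (lt_le_trans ltr01).
(* On [E1], [(3 / 2) ^+ k] pays for the last [P] factors of the weight, each at most [Bmax]. On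
   [E2], [(3 / 4) ^+ k] beats the constant [L2] of [window_upper]. *)
have [k1 Hk1] := geometric_unbounded (Bmax ^+ P) c32.
have [k2 Hk2] := geometric_unbounded (L2 + 1) c43.
pose k := maxn k1 k2.
have {}Hk1 : Bmax ^+ P <= (3 / 2) ^+ k by apply: Hk1; rewrite leq_maxl.
have {}Hk2 : L2 * (3 / 4) ^+ k < 1.
  have Hk3 : L2 + 1 <= (4 / 3) ^+ k by apply: Hk2; rewrite leq_maxr.
  have -> : (3 / 4 : R) = (4 / 3)^-1 by field.
  rewrite exprVn ltr_pdivrMr ?mul1r ?exprn_gt0 ?(lt_trans _ c43)//.
  by rewrite (lt_le_trans _ Hk3)// ltrDl.
have WP x : (\prod_(i < k + P) w_ (iter i f x)) ^+ P =
    \prod_(i < k) a (iter i f x) * \prod_(j < P) a (iter (k + j) f x).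
  by rewrite -prodrXl big_split_ord /=; congr (_ * _); apply: eq_bigr => i _;
    exact: wP.
have W0 x m : 0 < \prod_(i < m) w_ (iter i f x) by apply: prodr_gt0.
have A0 x m : 0 < \prod_(i < m) a (iter i f x) by apply: prodr_gt0.
have sPE x v j : N (iter (j + P) f x) (fpush (j + P) x v) =
    N (iter P f (iter j f x)) (fpush P (iter j f x) (fpush j x v)).
  by rewrite addnC iterD push_addn.
have k_gt0 : (0 < k + P)%N by rewrite addn_gt0 P0 orbT.
exists (k + P)%N, w_; split => //.
- move=> x; have ac : {for x, continuous a} by apply: cvgM;
  [exact: cvg_cst | exact: bc].
  have lc := @continuous_comp M R R a (@ln R) x ac (continuous_ln (a0 x)).
  have lPc : {for x, continuous (fun y => ln (a y) / P%:R)}.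
    by apply: cvgM; [exact: lc | exact: cvg_cst].
  exact: (@continuous_comp M R R _ (@expR R) x lPc (@continuous_expR R _)).
- move=> x; rewrite expR_gt1 divr_gt0 ?ltr0n// ln_gt0//.
  exact: lt_le_trans (a43 x).
- move=> x v v1; have [->|v0] := eqVneq v 0.
    by rewrite (push_zero f (tmap_linear f)) !tnorm0 mulr0.
  pose s j := N (iter j f x) (fpush j x v).
  have s0 j : 0 < s j by apply: tnorm_gt0 => //; exact: push_neq0.
  have := @window_lower R P s (fun j => a (iter j f x)) (3 / 2) s0
    (fun _ => a0 _) _ k.
  rewrite divr_gt0// => /(_ isT) H.
  rewrite -(@ler_pXn2r _ P)// ?nnegrE ?mulr_ge0 ?tnorm_ge0 ?(ltW (W0 _ _))//.
  apply: le_trans (H _ _); last 2 first.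
  - move=> j; rewrite /s sPE; apply: le_trans (b1 _ _ (push_E1 j v1)).
    by rewrite ler_wpM2r ?tnorm_ge0// /a; lra.
  - move=> j; rewrite /s /=; apply: le_trans (expansion (push_E1 j v1)).
    by rewrite ler_peMl ?tnorm_ge0// ltW.
  have sv0 : 0 < N x v := s0 0%N.
  rewrite exprMn WP ler_pM2r ?exprn_gt0// mulrC ler_pM2r//.
  apply: le_trans Hk1; rewrite -[X in _ <= _ ^+ X](card_ord P) -prodr_const.
  by apply: ler_prod => j _; rewrite ltW//=.
move=> x v v2 v0.
pose s j := N (iter j f x) (fpush j x v).
have s0 j : 0 < s j by apply: tnorm_gt0 => //; exact: push_neq0.
have := @window_upper R P s (fun j => a (iter j f x)) (3 / 4) s0 (fun _ => a0 _)
  _ k L L1.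
rewrite divr_gt0// => /(_ isT) H.
rewrite -(@ltr_pXn2r _ P)// ?nnegrE ?mulr_ge0 ?tnorm_ge0 ?(ltW (W0 _ _))//.
apply: le_lt_trans (H _ _) _.
- move=> j; rewrite /s sPE; apply: (le_trans (b2 _ _ (push_E2 j v2))).
  by rewrite ler_wpM2r ?tnorm_ge0// /a; lra.
- by move=> j; exact: HL.
have sv0 : 0 < N x v := s0 0%N.
rewrite -/L2 !mulrA [X in _ < X]exprMn WP ltr_pM2r ?exprn_gt0//.
apply: (@lt_le_trans _ _ (\prod_(i < k) a (iter i f x)));
  first by rewrite gtr_pMl.
rewrite ler_peMr ?(ltW (A0 _ _))//.
elim/big_ind: _ => // [y z y1 z1|j _]; first exact: mulr_ege1.
by apply: le_trans (a43 _); rewrite ltW.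
Qed.

(* Gourmelon's adapted metric: with a weight w_ lying between the growth rates
   of the two bundles, the form sum_(k < T) |A^k v|^2 / W_k^2, where
   W_k = w_ (w_ o f) ... (w_ o f^(k-1)), is multiplied by at least w_^2 on E^u
   and by less than w_^2 on E^cs. *)
Lemma adapted_metric : exists2 q : M -> V -> V -> R,
  continuous_riemannian_metric q &
  (forall x v, v \in E1 x -> tnorm q x v = 1 -> 1 < tnorm q (f x) (tmap f x v))
    /\
  (forall x w v, w \in E2 x -> v \in E1 x -> tnorm q x w = 1 ->
    tnorm q x v = 1 ->
     tnorm q (f x) (tmap f x w) < tnorm q (f x) (tmap f x v)).
Proof.
have [T [w_ [T0 wc w1 wE1 wE2]]] := adapted_weight.
have w0 x : 0 < w_ x by exact: lt_trans (w1 x).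
pose W k x := \prod_(i < k) w_ (iter i f x).
have W0 k x : 0 < W k x by apply: prodr_gt0.
have WS k x : W k.+1 x = w_ x * W k (f x).
  by rewrite /W big_ord_recl; congr (_ * _); apply: eq_bigr => i _;
    rewrite -iterSr.
have Wc k : continuous (W k).
  elim: k => [|k IH] x.
    rewrite /continuous_at /W big_ord0 (_ : (fun _ => _) = cst 1);
      first exact: cvg_cst.
    by apply/funext => y; rewrite big_ord0.
  rewrite /continuous_at WS (funext (WS k)); apply: cvgM; first exact: wc.
  exact: (@continuous_comp M M R f (W k) x (Cf.1 x) (IH _)).
pose q x v w := \sum_(k < T) (W k x ^+ 2)^-1 *
  g (iter k f x) (fpush k x v) (fpush k x w).
have Winv k x : 0 < (W k x ^+ 2)^-1 by rewrite invr_gt0 exprn_gt0.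
have q_ip : inner_products q.
  split.
  - move=> x a v v' w; rewrite mulr_sumr -big_split; apply: eq_bigr => k _ /=.
    by rewrite (push_lin f (tmap_linear f)) (inner_linear g_ip); ring.
  - by move=> x v w; apply: eq_bigr => k _; rewrite (inner_sym g_ip).
  - move=> x v v0; rewrite /q; case: T T0 {wE1 wE2 q} => // T _.
    rewrite big_ord_recl ltr_pwDl//.
      by rewrite mulr_gt0//; exact: inner_pos.
    by apply: sumr_ge0 => k _; rewrite mulr_ge0 ?inner_ge0// ltW.
have q_cvg x v : q z.1 z.2 z.2 @[z --> tnbhs x v] --> q x v v.
  apply: (@cvg_sumr R R^o) => k; apply: cvgM.
    have Wz : (fun z : M * V => W k z.1) @ tnbhs x v --> W k x.
      exact: (cvg_comp _ _ (@tnbhs_fst _ _ _ x v) (@Wc k x)).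
    apply: cvgV; first by rewrite gt_eqF// exprn_gt0.
    rewrite expr2 (_ : (fun z => _) = (fun z : M * V => W k z.1 * W k z.1)).
      exact: cvgM.
    by apply/funext => z; rewrite expr2.
  exact: (cvg_comp _ _ (push_cvg Cf (k := k) (x := x) (v := v))
    (metric_cvg g_ip g_cont (x := iter k f x) (v := fpush k x v))).
(* Applying [Df] shifts the sum by one index: the term 0 leaves and the term [T] enters.
   [adapted_weight] decides the sign of the difference on each bundle. *)
have step x v : q (f x) (tmap f x v) (tmap f x v) = w_ x ^+ 2 * (q x v v +
    ((N (iter T f x) (fpush T x v) / W T x) ^+ 2 - N x v ^+ 2)).
  pose t k := (W k x ^+ 2)^-1 * g (iter k f x) (fpush k x v) (fpush k x v).
  have tT : (N (iter T f x) (fpush T x v) / W T x) ^+ 2 = t T.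
    by rewrite exprMn sqr_tnorm// exprVn mulrC.
  have t0 : N x v ^+ 2 = t 0%N.
    by rewrite sqr_tnorm// /t /W big_ord0 expr1n invr1 mul1r.
  have -> : q (f x) (tmap f x v) (tmap f x v) = \sum_(k < T) w_ x ^+ 2 * t k.+1.
    apply: eq_bigr => k _; rewrite -pushSr -iterSr /t WS.
    by field; rewrite !gt_eqF.
  rewrite -mulr_sumr tT t0; congr (_ * _).
  have : \sum_(k < T.+1) t k = t 0%N + \sum_(k < T) t k.+1
    by rewrite big_ord_recl.
  by rewrite big_ord_recr /= -/(q x v v) => H; rewrite addrA H addrC addKr.
have q0 x v : 0 <= q x v v by exact: inner_ge0.
have q1 x v : tnorm q x v = 1 -> q x v v = 1.
  by move=> v1; rewrite -(sqr_tnorm q_ip) v1 expr1n.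
have upper x w : w \in E2 x -> tnorm q x w = 1 ->
  tnorm q (f x) (tmap f x w) < w_ x.
  move=> w2 w_1.
  have w_neq0 : w != 0.
    by apply/eqP => w_0; move/eqP: w_1;
      rewrite w_0 /tnorm (inner_zero q_ip) sqrtr0 eq_sym oner_eq0.
  rewrite -(@ltr_pXn2r _ 2)// ?nnegrE ?tnorm_ge0 ?(ltW (w0 x))//.
  rewrite sqr_tnorm// step (q1 _ _ w_1) -[ltRHS]mulr1 ltr_pM2l ?exprn_gt0//.
  rewrite gtrDl subr_lt0 ltr_pXn2r ?nnegrE ?divr_ge0 ?tnorm_ge0
    ?(ltW (W0 _ _))//.
  by rewrite ltr_pdivrMr// mulrC; exact: wE2.
have lower x v : v \in E1 x -> tnorm q x v = 1 ->
  w_ x <= tnorm q (f x) (tmap f x v).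
  move=> v1 v_1.
  rewrite -(@ler_pXn2r _ 2)// ?nnegrE ?tnorm_ge0 ?(ltW (w0 x))//.
  rewrite sqr_tnorm// step (q1 _ _ v_1) -[leLHS]mulr1 ler_pM2l ?exprn_gt0//.
  rewrite lerDl subr_ge0 ler_pXn2r ?nnegrE ?divr_ge0 ?tnorm_ge0
    ?(ltW (W0 _ _))//.
  by rewrite ler_pdivlMr// mulrC; exact: wE1.
exists q; first by split => //; exact: polarization_metric.
split=> [x v v1 v_1|x w v w2 v1 w_1 v_1].
  exact: lt_le_trans (w1 x) (lower _ _ v1 v_1).
exact: lt_le_trans (upper _ _ w2 w_1) (lower _ _ v1 v_1).
Qed.

End Adapted.

(** * Linear images of subspaces and finite intersections *)

Lemma row_linear_surj (R : realType) (n : nat) (L : 'rV[R]_n -> 'rV[R]_n) :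
  linear L -> (forall v, L v = 0 -> v = 0) -> forall w, exists v, L v = w.
Proof.
move=> Llin Linj w.
pose F : {linear 'rV[R]_n -> 'rV[R]_n} := HB.pack L
  (GRing.isLinear.Build R 'rV[R]_n 'rV[R]_n *:%R L Llin).
have ker0 : lker (linfun F) == 0%VS.
  rewrite -subv0; apply/subvP => v; rewrite memv_ker lfunE memv0 => /eqP Fv.
  by apply/eqP/Linj.
have : w \in limg (linfun F) by rewrite (lker0_limgf ker0) memvf.
by move=> /memv_imgP[v _ ->]; exists v; rewrite lfunE.
Qed.

Lemma linear_image_subspace (R : realType) (d n : nat)
  (L : 'rV[R]_d -> 'rV[R]_n)
    (W : {vspace 'rV[R]_d}) :
  linear L -> (forall v, L v = 0 -> v = 0) ->
  exists2 U : {vspace 'rV[R]_n}, \dim U = \dim W &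
    forall w, w \in U -> exists2 v, v \in W & w = L v.
Proof.
move=> Llin Linj.
pose F : {linear 'rV[R]_d -> 'rV[R]_n} := HB.pack L
  (GRing.isLinear.Build R 'rV[R]_d 'rV[R]_n *:%R L Llin).
exists (linfun F @: W)%VS; last by move=> w /memv_imgP[v vW ->]; exists v;
  rewrite ?lfunE.
rewrite limg_dim_eq//; apply/eqP; rewrite -subv0;
  apply/subvP => v /memv_capP[_].
by rewrite memv_ker lfunE memv0 => /eqP /Linj ->.
Qed.

Lemma near_finite (T I : Type) (F : set_system T) {FF : Filter F} (J : set I)
    (P : I -> T -> Prop) : finite_set J -> (forall i, J i -> F (P i)) ->
  F [set z | forall i, J i -> P i z].
Proof.
move=> fJ FP.
(* The alias [{classic I}] gives the arbitrary type [I] the choice structure that finite sets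
   require. *)
have /finite_fsetP[D DE] : finite_set (J : set {classic I}) by [].
have : F (\bigcap_(i in (J : set {classic I})) (P i : set T)).
  rewrite DE; apply: filter_bigI => i iD; apply: FP.
  by have : (J : set {classic I}) i by rewrite DE.
by apply: filterS => z Pz i Ji; exact: Pz.
Qed.

(** * Boxes *)

Section Box.
Context {R : realType} {u s : nat} {M : closed_manifold R (u + s)}.
Local Notation V := 'rV[R]_(u + s).

Lemma cube_compact : compact (cube : set V).
Proof.
have -> : (cube : set V) = [set v | forall i, `[-1, 1]%classic (v ord0 i)].
  by apply/funext => v; apply/propext; split=> H i; have := H i;
    rewrite /= in_itv /= ler_norml.
exact: (@rV_compact R _ (fun=> `[-1, 1]%classic)
  (fun=> @segment_compact R (-1) 1)).
Qed.

Variable b : weak_box M.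
Local Notation phi := (param b).

Lemma param_continuous p : cube p -> {for p, continuous phi}.
Proof. by have [U [oU cU [cphi _]]] := param_C1 b; move=> /cU; exact: cphi. Qed.

Definition dparam a (p v : V) : V := 'd (Defs.coord a \o phi) p v.

Lemma dparam_C1 a p : cube p -> dom a (phi p) -> C1_at (Defs.coord a \o phi) p.
Proof.
have [U [oU cU [cphi Cphi]]] := param_C1 b; move=> cp ap.
apply: Ck1_C1_at (Cphi a); apply: filterI.
  by apply: open_nbhs_nbhs; split => //; exact: cU.
exact: param_continuous cp _ (near_dom ap).
Qed.

Lemma dparam_linear a p : linear (dparam a p).
Proof. by move=> r v w; rewrite /dparam linearP. Qed.

Lemma tparam_linear p : linear (tparam phi p).
Proof. by move=> r v w; rewrite /tparam linearP. Qed.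

Lemma tparam_chart a p v : cube p -> dom a (phi p) ->
  tparam phi p v = of_chart a (phi p) (dparam a p v).
Proof.
move=> cp ap; pose c := chart_at (phi p);
  have cc : dom c (phi p) := dom_chart_at _.
have dphi := C1_at_diff (dparam_C1 cp ap).
have dT := C1_at_diff (C1_map_at C1_map_id ap cc).
have dTphi := differentiable_comp dphi dT.
have dcomp := diff_comp dphi dT.
have near_eq : \forall y \near p,
    ((Defs.coord c \o id \o icoord a) \o (Defs.coord a \o phi)) y =
      (Defs.coord c \o phi) y.
  have nb : \forall y \near p, dom a (phi y) :=
    param_continuous cp (near_dom ap).
  by apply: filterS nb => y /= ay; rewrite coordK.
have [_ dE] := diff_near_eq dTphi near_eq.
apply: etrans (congr1 (fun F : V -> V => F v) dE) _.
exact: (congr1 (fun F : V -> V => F v) dcomp).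
Qed.

Lemma dparam_cvg a p v : cube p -> dom a (phi p) ->
  dparam a z.1 z.2 @[z --> (p, v)] --> dparam a p v.
Proof. by move=> cp ap; exact: (diff_joint_cvg (v := v) (dparam_C1 cp ap)). Qed.

Lemma dparam_inj a p v : cube p -> dom a (phi p) -> dparam a p v = 0 -> v = 0.
Proof.
move=> cp ap v0; apply: (param_immersion (w := b) cp).
by rewrite (tparam_chart _ cp ap) v0 (linear_zero (of_chart_linear a _)).
Qed.

Lemma tparam_surj p : cube p -> forall w, exists v, tparam phi p v = w.
Proof.
by move=> cp; apply: row_linear_surj (tparam_linear p) _ => v;
  exact: (param_immersion (w := b)).
Qed.

Lemma near_neq (T : Type) (X : topologicalType) (F : set_system T)
  {FF : Filter F}
  (h k : T -> X) (y z : X) : hausdorff_space X -> h @ F --> y -> k @ F --> z ->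
  y <> z -> \forall t \near F, h t <> k t.
Proof.
move=> hX hy kz yz.
move: hX; rewrite open_hausdorff => hX.
have [|[A B] /= [/set_mem Ay /set_mem Bz] [oA oB AB]] := hX y z;
  first exact/eqP.
have NA : nbhs y A by exact: open_nbhs_nbhs.
have NB : nbhs z B by exact: open_nbhs_nbhs.
have HA : \forall t \near F, A (h t) := hy _ NA.
have HB : \forall t \near F, B (k t) := kz _ NB.
apply: filterS2 HA HB => t At Bt hk.
move/eqP: AB => AB; suff : (A `&` B) (h t) by rewrite AB.
by split=> //; rewrite hk; exact: Bt.
Qed.

Lemma near_miss (x : M) : (forall p, cube p -> phi p <> x) ->
  \forall y \near x, forall p, cube p -> phi p <> y.
Proof.
move=> miss; apply: ((iffLR (compact_near_coveringP _) cube_compact) M (nbhs x)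
  (fun y p => phi p <> y) _) => p cp.
have H : \forall z \near (p, x), phi z.1 <> z.2.
  apply: (@near_neq _ _ (nbhs (p, x)) _ (fun z : V * M => phi z.1) snd (phi p)
    x).
  - exact: carrier_hausdorff.
  - exact: (cvg_comp fst phi (@fst_cvg _ _ p x) (param_continuous cp)).
  - exact: snd_cvg.
  - exact: miss.
exact: H.
Qed.

(* The same rescaling as in [proj_cvg] replaces the continuity of the inverse of
   the derivative of the parametrization. *)
Lemma near_box (p c : V) (P : V * V -> Prop) : cube p -> nbhs (p, c) P ->
  tnbhs (phi p) (tparam phi p c) [set z : M * V | forall p' c', cube p' ->
    phi p' = z.1 -> tparam phi p' c' = z.2 -> P (p', c')].
Proof.
move=> cp NP; pose x := phi p; pose a := chart_at x.
have ax : dom a x := dom_chart_at x.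
pose xi := tparam phi p c.
have xiE : dparam a p c = xi.
  by rewrite /xi (tparam_chart _ cp ax) -[LHS](of_chart_at (phi p)).
pose Q (z : M * V) (pct : V * (V * R)) := phi pct.1 = z.1 ->
  dparam a pct.1 pct.2.1 = pct.2.2 *: z.2 ->
  pct.2.2 != 0 /\ P (pct.1, pct.2.2^-1 *: pct.2.1).
have Kco := compact_setX cube_compact (@projective_compact R (u + s)).
have NQ : \forall z \near (x, xi), cube `*` projective `<=` Q z.
  apply: ((iffLR (compact_near_coveringP _) Kco) (M * V)%type (nbhs (x, xi)) Q
    _) => -[q [d t]] [/= cq Kdt].
  pose F := nbhs ((q, (d, t)), (x, xi)).
  have cq1 : (fun y : (V * (V * R)) * (M * V) => y.1.1) @ F --> q.
    exact: (cvg_comp fst fst (@fst_cvg _ _ (q, (d, t)) (x, xi))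
      (@fst_cvg _ _ q (d, t))).
  have c2 : (fun y : (V * (V * R)) * (M * V) => y.1.2) @ F --> (d, t).
    exact: (cvg_comp fst snd (@fst_cvg _ _ (q, (d, t)) (x, xi))
      (@snd_cvg _ _ q (d, t))).
  have cd : (fun y : (V * (V * R)) * (M * V) => y.1.2.1) @ F --> d.
    exact: (cvg_comp _ fst c2 (@fst_cvg _ _ d t)).
  have ct : (fun y : (V * (V * R)) * (M * V) => y.1.2.2) @ F --> t.
    exact: (cvg_comp _ snd c2 (@snd_cvg _ _ d t)).
  have cx : (fun y : (V * (V * R)) * (M * V) => y.2.1) @ F --> x.
    exact: (cvg_comp snd fst (@snd_cvg _ _ (q, (d, t)) (x, xi))
      (@fst_cvg _ _ x xi)).
  have cxi : (fun y : (V * (V * R)) * (M * V) => y.2.2) @ F --> xi.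
    exact: (cvg_comp snd snd (@snd_cvg _ _ (q, (d, t)) (x, xi))
      (@snd_cvg _ _ x xi)).
  have [qp|qp] := pselect (phi q = x); last first.
    have H : \forall y \near F, phi y.1.1 <> y.2.1.
      apply: (near_neq (@carrier_hausdorff R (u + s) M) _ cx qp).
      exact: (cvg_comp _ phi cq1 (param_continuous cq)).
    by apply: filterS H => y yneq /yneq.
  have {qp}qp : q = p by exact: param_inj qp.
  subst q.
  have [dt|dt] := pselect (dparam a p d = t *: xi); last first.
    have H : \forall y \near F, dparam a y.1.1 y.1.2.1 <> y.1.2.2 *: y.2.2.
      apply: (near_neq (@norm_hausdorff R V) _ _ dt).
        have cpd : (fun y : (V * (V * R)) * (M * V) => (y.1.1, y.1.2.1)) @ F -->
          (p, d).
          exact: cvg_to_pair.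
        exact: (cvg_comp _ _ cpd (dparam_cvg (v := d) cp ax)).
      exact: cvgZ.
    by apply: filterS H => y yneq _ /yneq.
  have dtc : d = t *: c.
    apply/subr0_eq/(dparam_inj cp ax).
    by rewrite addrC -scaleNr (dparam_linear a p) xiE dt scaleNr addNr.
  have t0 : t != 0.
    apply/eqP => t0; apply: (@projective_neq0 R (u + s)).
    by move: Kdt; rewrite dtc t0 scale0r.
  have cdt : (fun y : (V * (V * R)) * (M * V) => y.1.2.2^-1 *: y.1.2.1) @ F -->
    c.
    have -> : c = t^-1 *: d by rewrite dtc scalerA mulVf// scale1r.
    by apply: cvgZ => //; exact: cvgV.
  have nt0 : \forall r \near t, r != 0 by apply: open_nbhs_nbhs; split;
    [exact: open_neq | exact: t0].
  have H1 : \forall y \near F, y.1.2.2 != 0 := ct _ nt0.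
  have cP : (fun y : (V * (V * R)) * (M * V) => (y.1.1, y.1.2.2^-1 *: y.1.2.1))
    @ F --> (p, c).
    exact: cvg_to_pair.
  have H2 : \forall y \near F, P (y.1.1, y.1.2.2^-1 *: y.1.2.1) := cP _ NP.
  by apply: filterS2 H1 H2 => y y1 y2 _ _.
have near_a : \forall z \near (x, xi), dom a z.1.
  by apply: (@fst_cvg M V x xi (dom a)); exact: near_dom.
rewrite /tnbhs -/a; apply: filterS2 NQ near_a => -[y w] KQ ay /=
  p' c' cp' py /=.
have ap' : dom a (phi p') by rewrite py.
rewrite (tparam_chart _ cp' ap') py => /(can_inj (of_chartK ay)) lE.
have [m m0 Kc] := projective_rescale c'.
have [] := KQ (p', (m^-1 *: c', m^-1)); first by split.
- by [].
- by rewrite /= (linear_scale (dparam_linear a p')) lE.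
by move=> _ /=; rewrite invrK scalerA mulfV ?gt_eqF// scale1r.
Qed.

End Box.

(** * The union of the cones of finitely many boxes *)

Section BoxCones.
Context {R : realType} {u s : nat} {M : closed_manifold R (u + s)}.
Local Notation V := 'rV[R]_(u + s).
Variables (f h : M -> M) (I : Type) (B : I -> weak_box M) (J : set I).
Hypotheses (Cf : C1_map f) (Ch : C1_map h) (fK : cancel f h) (hK : cancel h f).
Hypothesis J_fin : finite_set J.
Hypothesis J_cov : forall x : M, exists2 i, J i & (param (B i) @` cube) x.
Hypothesis compat : compatible_unstable_cones f B.

Definition box_cone (x : M) (v : V) : Prop := exists2 i, J i & exists p c,
  [/\ cube p, param (B i) p = x,
    ucone (B i) p c & tparam (param (B i)) p c = v].

Lemma box_cone_scale x a v : box_cone x v -> box_cone x (a *: v).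
Proof.
move=> [i Ji [p [c [cp px Cc <-]]]]; exists i => //; exists p, (a *: c);
  split => //.
  exact: (family_cone (ucone_family (B i)) cp).
by rewrite (linear_scale (tparam_linear (B i) p)).
Qed.

Lemma box_cone_subspace x : exists2 W : {vspace V},
  [set` W] `<=` box_cone x & \dim W = u.
Proof.
have [i Ji [p cp px]] := J_cov x.
have [[W WC dW] _] := ucone_dim (B i) cp.
have [U dU UW] := linear_image_subspace W (tparam_linear (B i) p)
  (fun v => @param_immersion _ _ _ _ (B i) p v cp).
exists U; last by rewrite dU.
move=> w /= /UW[v vW ->]; exists i => //; exists p, v; split => //.
exact: WC.
Qed.

Lemma box_cone0 x : box_cone x 0.
Proof. by have [W WC _] := box_cone_subspace x; apply: WC;
  rewrite /= mem0v. Qed.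

Lemma tmap_inj x v : tmap f x v = 0 -> v = 0.
Proof.
by move=> v0; rewrite -(tmapK x v Cf Ch fK) v0 (linear_zero (tmap_linear h _)).
Qed.

Lemma box_cone_compat x v j q c : box_cone x v -> v != 0 -> cube q ->
  param (B j) q = f x -> tparam (param (B j)) q c = tmap f x v ->
  (ucone (B j) q)° c.
Proof.
move=> [i Ji [p [d [cp px Cd dv]]]] v0 cq qx qc.
have qx' : param (B j) q = f (param (B i) p) by rewrite px.
apply: (compat cp cq qx').
  by exists d => //=; rewrite px dv qc.
apply: contra_neq v0 => c0; apply: (@tmap_inj x).
by rewrite -qc c0 (linear_zero (tparam_linear (B j) q)).
Qed.

Lemma box_cone_closed x v : ~ box_cone x v ->
  tnbhs x v [set z : M * V | ~ box_cone z.1 z.2].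
Proof.
move=> nC.
have H : tnbhs x v [set z : M * V | forall i, J i -> forall p c, cube p ->
    param (B i) p = z.1 -> tparam (param (B i)) p c = z.2 -> ~ ucone (B i) p c].
  apply: (near_finite (P := fun i (z : M * V) => forall p c, cube p ->
    param (B i) p = z.1 -> tparam (param (B i)) p c = z.2 ->
      ~ ucone (B i) p c) J_fin) => i Ji.
  have [[p cp px]|miss] := pselect (exists2 p, cube p & param (B i) p = x);
    last first.
    have H : tnbhs x v [set z : M * V | forall p, cube p ->
      param (B i) p <> z.1].
      apply: (@tnbhs_fst R _ M x v
        (fun y => forall p, cube p -> param (B i) p <> y));
        apply: near_miss => p cp px.
      by apply: miss; exists p.
    by apply: filterS H => z zmiss p c cp /(zmiss p cp).
  have [c cv] := tparam_surj (B i) cp v.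
  have nCc : ~ ucone (B i) p c by move=> Cc; apply: nC; exists i => //;
    exists p, c.
  have ncl : \forall z \near (p, c), ~ (cube z.1 /\ ucone (B i) z.1 z.2).
    have := family_closed (ucone_family (B i)); rewrite -openC => op.
    by apply: open_nbhs_nbhs; split; [exact: op | move=> -[]].
  have H := near_box (B i) cp ncl; rewrite px cv in H.
  by apply: filterS H => z Hz p' c' cp' pz cz Cc; apply: (Hz p' c').
apply: filterS H => z Hz [i Ji [p [c [cp px Cc cz]]]].
exact: (Hz i Ji p c).
Qed.

(** A point near [f x] may leave any given box around [f x], so membership is proved in all boxes of
    [J] at once: compatibility handles those containing [f x], and the others miss a neighbourhood
    of it. Whichever box covers the nearby point then serves. *)
Lemma box_cone_open x v : box_cone x v -> v != 0 ->
  tnbhs (f x) (tmap f x v) [set z : M * V | box_cone z.1 z.2].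
Proof.
move=> Cv v0.
have H : tnbhs (f x) (tmap f x v)
  [set z : M * V | forall j, J j -> forall p c, cube p ->
    param (B j) p = z.1 -> tparam (param (B j)) p c = z.2 -> ucone (B j) p c].
  apply: (near_finite (P := fun j (z : M * V) => forall p c, cube p ->
    param (B j) p = z.1 -> tparam (param (B j)) p c = z.2 ->
      ucone (B j) p c) J_fin) => j Jj.
  have [[q cq qx]|miss] := pselect (exists2 q, cube q & param (B j) q = f x);
    last first.
    have H : tnbhs (f x) (tmap f x v)
      [set z : M * V | forall p, cube p -> param (B j) p <> z.1].
      apply: (@tnbhs_fst R _ M (f x) (tmap f x v)
        (fun y => forall p, cube p -> param (B j) p <> y));
        apply: near_miss => p cp px.
      by apply: miss; exists p.
    by apply: filterS H => z zmiss p c cp /(zmiss p cp).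
  have [c cv] := tparam_surj (B j) cq (tmap f x v).
  have Cc := box_cone_compat Cv v0 cq qx cv.
  have H := near_box (B j) cq (family_interior (ucone_family (B j)) cq Cc);
    rewrite qx cv in H.
  by apply: filterS H => z Hz p' c' cp' pz cz; exact: (Hz p' c').
apply: filterS H => -[y w] Hz.
have [j Jj [q cq qy]] := J_cov y; have [c cw] := tparam_surj (B j) cq w.
by exists j => //; exists q, c; split => //; exact: (Hz j Jj q c).
Qed.

(** At [x] several cones may overlap and a vertical space transverse to one need not avoid the
    others. One step later, compatibility puts the images of all of them inside the cone of a single
    box at [f x]; the preimage of the vertical space of that box works. *)
Lemma box_cone_transverse x : exists2 F : {vspace V}, \dim F = s &
  forall v, v \in F -> box_cone x v -> v = 0.
Proof.
have [j Jj [q cq qx]] := J_cov (f x).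
pose L (b : 'rV[R]_s) : V := tmap h (f x) (tparam (param (B j)) q (row_mx 0 b)).
have Llin : linear L.
  move=> a b b'; rewrite /L -(tmap_linear h) -(tparam_linear (B j));
    congr (tmap h _ (tparam _ _ _)).
  by rewrite scale_row_mx add_row_mx scaler0 addr0.
have Af b : tmap f x (L b) = tparam (param (B j)) q (row_mx 0 b).
  by rewrite -{1}(fK x) /L tmapK.
have Linj b : L b = 0 -> b = 0.
  move=> b0; have := Af b; rewrite b0 (linear_zero (tmap_linear f x)) => /esym.
  move=> /(param_immersion cq) /(congr1 (@rsubmx _ _ _ _)).
  by rewrite row_mxKr linear0.
have [F dF FL] := linear_image_subspace fullv Llin Linj.
exists F; first by rewrite dF dimvf dim_matrix; exact: mul1n.
move=> v /FL[b _ ->] Cb; apply/eqP; apply: contraTT isT => b0.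
have Cc := box_cone_compat Cb b0 cq qx (esym (Af b)).
have := ucone_transverse cq (interior_subset Cc);
  rewrite row_mxKl => /(_ erefl) r0.
by move/eqP: b0; rewrite /L r0 (linear_zero (tparam_linear (B j) q))
  (linear_zero (tmap_linear h _)).
Qed.

End BoxCones.

(** * The splitting determined by an invariant cone field *)

Section ConeSplitting.
Context {R : realType} {n : nat} {M : closed_manifold R n}.
Local Notation V := 'rV[R]_n.
Variables (g : M -> V -> V -> R) (f h : M -> M) (C : M -> V -> Prop)
  (u s : nat).
Hypotheses (g_ip : inner_products g) (g_cont : metric_class 0 g).
Hypotheses (Cf : C1_map f) (Ch : C1_map h) (fK : cancel f h) (hK : cancel h f).
Hypothesis us : (u + s)%N = n.
Hypothesis C0 : forall x, C x 0.
Hypothesis CZ : forall x a v, C x v -> C x (a *: v).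
Hypothesis C_closed : forall x v, ~ C x v ->
  tnbhs x v [set z : M * V | ~ C z.1 z.2].
Hypothesis C_open : forall x v, C x v -> v != 0 ->
  tnbhs (f x) (tmap f x v) [set z : M * V | C z.1 z.2].
Hypothesis C_sub : forall x, exists2 W : {vspace V},
  [set` W] `<=` C x & \dim W = u.
Hypothesis C_transverse : forall x, exists2 W : {vspace V}, \dim W = s &
  forall v, v \in W -> C x v -> v = 0.
Variable lambda : R.
Hypothesis lambda_gt1 : 1 < lambda.
Hypothesis C_expanded : forall x v, C x v ->
  lambda * tnorm g x v <= tnorm g (f x) (tmap f x v).

Local Notation A := (tmap f).
Local Notation fpush := (push f A).
Local Notation hpush := (push h (tmap h)).
Local Notation esc := (avoids f A C).
Local Notation trp := (trapped C h (tmap h)).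

Let A_inj x v : A x v = 0 -> v = 0.
Proof. by move=> v0; rewrite -(tmapK x v Cf Ch fK) v0
  (linear_zero (tmap_linear h _)). Qed.

Let fK' x v : tmap h (f x) (A x v) = v.
Proof. exact: tmapK. Qed.

Let hK' x v : A (h x) (tmap h x v) = v.
Proof. exact: tmapK. Qed.

Lemma cone_eps : exists e, [/\ 0 < e, e < 1 & forall x v w, C x v ->
    tnorm g (f x) (w - A x v) <= e * tnorm g (f x) (A x v) -> C (f x) w].
Proof. exact: uniform_cone. Qed.

Lemma C_tmap x v : C x v -> C (f x) (A x v).
Proof.
move=> Cv; have [->|v0] := eqVneq v 0;
  first by rewrite (linear_zero (tmap_linear f x)).
exact: tnbhs_singleton (C_open Cv v0).
Qed.

Lemma push_linear (f' : M -> M) k x : linear (push f' (tmap f') k x).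
Proof. by move=> a v w; exact: push_lin (tmap_linear f') _ _ _ _ _. Qed.

Lemma push_injective (f' h' : M -> M) k x v : C1_map f' -> C1_map h' ->
  cancel f' h' ->
  push f' (tmap f') k x v = 0 -> v = 0.
Proof.
move=> C1 C2 K; elim: k => //= k IH kv0; apply: IH.
by rewrite -(tmapK (iter k f' x) (push f' (tmap f') k x v) C1 C2 K) kv0
  (linear_zero (tmap_linear h' _)).
Qed.

Lemma hpush_fpush k x v : hpush k x (fpush k (iter k h x) v) = v.
Proof.
by have := push_cancel fK fK' k (iter k h x) v; rewrite (iter_cancel hK).
Qed.

Lemma fpush_hpush k x v : fpush k x (hpush k (iter k f x) v) = v.
Proof.
by have := push_cancel hK hK' k (iter k f x) v; rewrite (iter_cancel fK).
Qed.

Lemma trapped_subspace x : exists2 U : {vspace V},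
  [set` U] `<=` trp x & \dim U = u.
Proof.
pose Ck k := [set v | C (iter k h x) (hpush k x v)].
have Ccl k : closed (Ck k).
  rewrite -openC openE => v nC.
  have nw : \forall w \near hpush k x v, ~ C (iter k h x) w :=
    tnbhs_fibre (C_closed nC).
  exact: (row_linear_continuous (push_linear h k x) nw).
have Cdec k : Ck k.+1 `<=` Ck k.
  by move=> v /= /C_tmap; rewrite hK hK'.
have CW k : exists2 W : {vspace V}, [set` W] `<=` Ck k & \dim W = u.
  have [W WC <-] := C_sub (iter k h x).
  have [U dU UW] := linear_image_subspace W (push_linear f k (iter k h x))
    (fun v => @push_injective f h k _ v Cf Ch fK).
  exists U => // w /= /UW[v vW ->]; rewrite /Ck /= hpush_fpush.
  exact: WC.
have [U UC dU] := nested_subspace Ccl Cdec CW.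
by exists U => // v /= vU k; exact: (UC k v vU).
Qed.

Lemma avoids_subspace x : exists2 S : {vspace V},
  [set` S] `<=` esc x & \dim S = s.
Proof.
(* [nested_subspace] needs closed sets, but the complement of a closed cone is open; the complement
   of an interior is used instead. Removing 0 from the cone keeps 0 in [Ck k] even if the cone is
   the whole fibre. *)
pose G k := [set w | C (iter k f x) w /\ w != 0].
pose Ck k := [set v | ~ (G k)° (fpush k x v)].
have G_step k w : G k w -> (G k.+1)° (A (iter k f x) w).
  move=> [Cw w0]; rewrite /interior.
  have H1 : \forall z \near A (iter k f x) w, C (iter k.+1 f x) z :=
    tnbhs_fibre (C_open Cw w0).
  have H2 : \forall z \near A (iter k f x) w, z != 0.
    have o0 : open [set z : V | z != 0].
      rewrite (_ : [set z : V | z != 0] = ~` [set 0]).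
        exact/closed_openC/accessible_closed_set1/hausdorff_accessible/norm_hausdorff.
      by apply/funext => z; apply/propext; split=> /eqP.
    apply: open_nbhs_nbhs; split=> //=.
    by apply: contra_neq w0; exact: A_inj.
  exact: filterI.
have Ccl k : closed (Ck k).
  rewrite -openC openE => v /contrapT Gv.
  have nG : \forall w \near v, (G k)° (fpush k x w) :=
    row_linear_continuous (push_linear f k x) (nbhs_interior Gv).
  by apply: filterS nG => w Gw; apply.
have Cdec k : Ck k.+1 `<=` Ck k.
  by move=> v /= nG /interior_subset /G_step.
have CW k : exists2 W : {vspace V}, [set` W] `<=` Ck k & \dim W = s.
  have [W <- WC] := C_transverse (iter k f x).
  have [U dU UW] := linear_image_subspace W (push_linear h k (iter k f x))
    (fun v => @push_injective h f k _ v Ch Cf hK).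
  exists U => // w /= /UW[v vW ->];
    rewrite /Ck /= fpush_hpush => /interior_subset[Cv].
  by rewrite (WC v vW Cv) eqxx.
have [S SC dS] := nested_subspace Ccl Cdec CW.
exists S => // v /= vS k Ck'; apply/eqP; apply: contraT => v0.
(* A nonzero cone vector at time [k] is only known to be interior one step later, hence the index
   [k.+1]. *)
by case: (SC k.+1 v vS); exact: (G_step k).
Qed.

Lemma cone_splitting_at x : exists U S : {vspace V},
  [/\ forall v, v \in U <-> trp x v, forall v, v \in S <-> esc x v,
      \dim U = u, (S + U)%VS = fullv & (S :&: U)%VS = 0%VS].
Proof.
have [U Utr dU] := trapped_subspace x; have [S Sesc dS] := avoids_subspace x.
have cap0 : (S :&: U)%VS = 0%VS.
  apply/eqP; rewrite -subv0; apply/subvP => v /memv_capP[vS vU].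
  rewrite memv0; apply/eqP.
  exact: (trapped_avoids_eq0 (Utr _ vU) (Sesc _ vS)).
have sum1 : (S + U)%VS = fullv.
  apply/eqP; rewrite eqEdim subvf /= dimvf dim_matrix dimv_disjoint_sum// dS dU.
  by rewrite addnC us (_ : (1 * n)%R = n)//; exact: mul1n.
have [e [e0 e1 He]] := cone_eps.
exists U, S; split => //.
- move=> v; split=> [/Utr//|vtr].
  have : v \in (S + U)%VS by rewrite sum1 memvf.
  move=> /memv_addP[b bS [a aU vE]].
  have b0 : b = 0.
    apply: (trapped_split (tmap_linear f) (tnorm_scale g_ip)
      (tnorm_triangle g_ip)
      (tnorm_gt0 g_ip) CZ A_inj e0 e1 He (tmap_linear h) hK hK' vtr (Utr _ aU)
        (Sesc _ bS)).
    by rewrite vE addrC.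
  by rewrite vE b0 add0r.
- move=> v; split=> [/Sesc//|vesc].
  have : v \in (S + U)%VS by rewrite sum1 memvf.
  move=> /memv_addP[b bS [a aU vE]].
  have a0 : a = 0.
    apply: (avoids_split (tmap_linear f) (tnorm_scale g_ip)
      (tnorm_triangle g_ip)
      (tnorm_gt0 g_ip) CZ A_inj e0 e1 He hK hK' vesc (Utr _ aU) (Sesc _ bS)).
    by rewrite vE addrC.
  by rewrite vE a0 addr0.
Qed.

Lemma cone_splitting : exists Ecs Eu : M -> {vspace V},
  weak_ph_splitting g f u Ecs Eu.
Proof.
have [Eu /choice[Ecs H]] := choice cone_splitting_at.
have [EuP EcsP dEu sum1 cap0] : [/\ forall x v, v \in Eu x <-> trp x v,
    forall x v, v \in Ecs x <-> esc x v, forall x, \dim (Eu x) = u,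
    forall x, (Ecs x + Eu x)%VS = fullv & forall x, (Ecs x :&: Eu x)%VS = 0%VS].
  by split=> x; have [] := H x.
have [e [e0 e1 He]] := cone_eps.
have Eu_C x v : v \in Eu x -> C x v by move=> /EuP /(_ 0%N).
have Eu_back x v : v \in Eu x -> tmap h x v \in Eu (h x).
  by move=> /EuP vtr; apply/EuP => k; rewrite -iterSr -pushSr; exact: vtr.
have Eu_inv x v : v \in Eu x -> A x v \in Eu (f x).
  move=> vu; apply/EuP => -[|k] /=; first exact/C_tmap/Eu_C.
  by rewrite -iterS -[tmap h _ _]/(hpush k.+1 _ _) iterSr pushSr fK fK';
    move/EuP : vu; apply.
have Ecs_invE x v : v \in Ecs x <-> A x v \in Ecs (f x).
  split=> [/EcsP|/EcsP] vcs; apply/EcsP.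
    exact: (avoids_step (tnorm_scale g_ip) (tnorm_gt0 g_ip) A_inj e0 He x v).1.
  exact: (avoids_step (tnorm_scale g_ip) (tnorm_gt0 g_ip) A_inj e0 He x v).2.
have Eu_closed : closed_family Eu.
  move=> x v /negP vu.
  have [k nC] : exists k, ~ C (iter k h x) (hpush k x v).
    by apply/existsNP => Cv; apply/vu/EuP.
  have nz : tnbhs x v [set z : M * V | ~ C (iter k h z.1) (hpush k z.1 z.2)] :=
    push_cvg Ch (C_closed nC).
  by apply: filterS nz => z nCz; apply/negP => /EuP /(_ k).
have Ecs_closed : closed_family Ecs.
  move=> x v /negP vcs.
  have [k] : exists k, ~ (C (iter k f x) (fpush k x v) -> fpush k x v = 0).
    by apply/existsNP => Cv; apply/vcs/EcsP.
  move=> /not_implyP[Ck /eqP k0].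
  have v0 : v != 0 by apply: contra_neq k0 => ->;
    exact: linear_zero (push_linear f k x).
  (* Being in the cone at time [k] is not stable under perturbation, but by [C_open] being there at
     time [k.+1] is. A nearby vector must also be nonzero, since the zero vector avoids the cone. *)
  have nz : tnbhs x v [set z : M * V | C (iter k.+1 f z.1)
    (fpush k.+1 z.1 z.2)].
    exact: (push_cvg Cf (k := k.+1) (C_open Ck k0)).
  have nz0 : tnbhs x v [set z : M * V | 0 < tnorm g z.1 z.2].
    by have := cvgr_gt _ (tnorm_cvg g_ip g_cont (x := x) (v := v)); apply;
      exact: tnorm_gt0.
  apply: filterS2 nz nz0 => z Cz z0; apply/negP => /EcsP /(_ k.+1 Cz) kz0.
  by move: z0; rewrite /= (push_injective Cf Ch fK kz0) (tnorm0 g_ip) ltxx.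
have E12 x v : v \in Eu x -> v \in Ecs x -> v = 0.
  by move=> v1 v2; apply/eqP; rewrite -memv0 -(cap0 x) memv_cap v1 v2.
have /choice[pz p12] (z : M * V) : exists a,
  a \in Eu z.1 /\ z.2 - a \in Ecs z.1.
  case: z => x v /=; have : v \in (Ecs x + Eu x)%VS by rewrite sum1 memvf.
  by move=> /memv_addP[b bS [a aU ->]]; exists a; rewrite addrK.
pose p x v := pz (x, v).
have p1 x v : p x v \in Eu x by have [] := p12 (x, v).
have p2 x v : v - p x v \in Ecs x by have [] := p12 (x, v).
have dEcs x : \dim (Ecs x) = s.
  have := dimv_disjoint_sum (cap0 x); rewrite sum1 dEu dimvf dim_matrix.
  have -> : (1 * n)%R = (s + u)%N by rewrite addnC us; exact: mul1n.
  by move=> /addIn.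
have p_cvg x v := proj_cvg Eu_closed Ecs_closed E12 p1 p2 (x := x) (v := v).
exists Ecs, Eu; split => //.
(* The roles of the bundles are exchanged, with the complementary projection. *)
- apply: (@splitting_subbundle R n M Ecs Eu Ecs_closed Eu_closed _
  (fun x v => v - p x v)) => //.
  + by move=> x v v1 v2; exact: E12 v2 v1.
  + by move=> x v; rewrite opprB addrC subrK.
  + by move=> x y; rewrite !dEcs.
- by apply: (splitting_subbundle Eu_closed Ecs_closed E12 p1 p2) => x y;
  rewrite !dEu.
- move=> x; apply/seteqP; split=> [_ [v /= vcs <-]|v /= vcs];
  first exact: (Ecs_invE x v).1.
  exists (tmap h (f x) v); last by rewrite -{1}(fK x) hK'.
  by apply/Ecs_invE; rewrite -[X in tmap f X](fK x) hK'.
- move=> x; apply/seteqP; split=> [_ [v /= vu <-]|v /= vu]; first exact: Eu_inv.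
  exists (tmap h (f x) v); last by rewrite -{1}(fK x) hK'.
  by rewrite /= -[X in Eu X](fK x); exact: Eu_back.
- by exists lambda => // x v /Eu_C; exact: C_expanded.
(* This is the [kappa] of [trapped_domination] for [eps = e]. *)
have k0 : 0 < e ^+ 3 / 2 by rewrite divr_gt0// exprn_gt0.
apply: (adapted_metric g_ip g_cont Cf Ch fK hK Eu_inv Eu_back _ p1 _ _ p_cvg k0
  lambda_gt1 _ _).
- by move=> x v /Ecs_invE.
- by move=> x v v1; exact: (proj_id E12 p1 p2 v1).
- by move=> x a v w; exact: (proj_linear E12 p1 p2).
- move=> x v w k /EuP vu /EcsP wcs.
  exact: (trapped_domination (tmap_linear f) (tnorm_scale g_ip)
    (tnorm_triangle g_ip)
      (tnorm_gt0 g_ip) CZ A_inj e0 e1 He hK hK').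
- by move=> x v /Eu_C; exact: C_expanded.
Qed.

End ConeSplitting.

Theorem proposition3p6 (R : realType) (u s : nat)
  (M : closed_manifold R (u + s))
  (g : M -> 'rV[R]_(u + s) -> 'rV[R]_(u + s) -> R)
  (f : M -> M) (I : Type) (B : I -> weak_box M) :
  riemannian_metric g ->
  C1_diffeo f ->
  covering B ->
  compatible_unstable_cones f B ->
  cones_uniformly_expanded g f B ->
  exists Ecs Eu : M -> {vspace 'rV[R]_(u + s)},
    weak_ph_splitting g f u Ecs Eu.
Proof.
move=> [g_ip g_smooth] [h [Cf Ch fK hK]] [J J_fin J_cov] compat [lambda l1 exp].
apply: (@cone_splitting R (u + s) M g f h (box_cone B J) u s g_ip (g_smooth 0%N)
  Cf Ch fK hK erefl) l1 _.
- exact: box_cone0.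
- by move=> x a v; exact: box_cone_scale.
- by move=> x v; exact: box_cone_closed.
- by move=> x v; exact: (box_cone_open Cf Ch fK J_fin J_cov compat).
- exact: box_cone_subspace.
- exact: (box_cone_transverse Cf Ch fK hK J_cov compat).
- by move=> x v [i _ [p [c [cp <- Cc <-]]]]; exact: exp.
Qed.
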